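(* For any multi-index $\nu=(\nu_1,\nu_2)$ with $|\nu|=n\ge1$, the local surface parametrization $z(\lambda)=\alpha(\lambda)x(\lambda)$ on a cut tetrahedron (defined in the context) satisfies $$\left|\partial_\lambda^\nu z(\lambda)\right|\le C\,h^{\lfloor n/2\rfloor+1},\qquad \lambda=(\lambda_1,\lambda_2)\in\widehat K,$$ where $C$ may depend on $n$, on the smoothness and geometry of $\Gamma$, on the mesh shape-regularity constant, and on the uniform transversality constant, but is independent of $h$.
   Context: $\Gamma=\{x\in\mathbb{R}^3:F(x)=0\}$ is a compact regular level set ($\nabla F\neq0$ on $\Gamma$) of a smooth function $F$ with as many bounded derivatives near $\Gamma$ as needed. $r_\Gamma$ is the reach of $\Gamma$ (the supremum of all $r>0$ such that every $x$ with $\operatorname{dist}(x,\Gamma)<r$ has a unique closest point on $\Gamma$), $K_\Gamma$ is the maximum absolute principal curvature, and $n(\cdot)$ is the unit normal. We consider a family of shape-regular, quasi-uniform conforming tetrahedral meshes. On a cut tetrahedron $T$ (one with $T\cap\Gamma\ne\emptyset$) write $h=h_T=\operatorname{diam}T$. Every cut $T$ is consistent with $\Gamma$: $h_T<r_\Gamma$, $h_TK_\Gamma\le\frac14$, and $\operatorname{dist}(a,\Gamma)>\max\{c_0h_T,K_\Gamma h_T^2\}$ for each vertex $a$ of $T$. It is also uniformly transverse: $|n(z)\cdot\frac{a-z}{|a-z|}|\ge c_2>0$ for each apex vertex $a$ used below and all $z\in T\cap\Gamma$. The constants $c_0,c_2>0$ are independent of $h$ and $T$. Charts. (i) If one vertex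 $o_0$ of $T=\overline{o_0o_1o_2o_3}$ has a sign of $F$ different from that of the other three, set $S=T$, take apex $o_0$, and let $p,q,r$ be the unique intersections of $\Gamma$ with $\overline{o_0o_1},\overline{o_0o_2},\overline{o_0o_3}$. (ii) If $o_0,o_1$ have one sign and $o_2,o_3$ the other, let $m$ be the unique point of $\overline{o_1o_2}\cap\Gamma$ and split $T$ into $T_1=\operatorname{conv}\{o_0,o_1,o_3,m\}$ and $T_2=\operatorname{conv}\{o_0,o_2,o_3,m\}$. For $S=T_1$ take apex $o_3$ and $p,q,r$ the intersections of $\Gamma$ with the three edges of $T_1$ at $o_3$ (on $\overline{o_3m}$ this is $m$). For $S=T_2$ take apex $o_0$ and $p,q,r$ the intersections of $\Gamma$ with the three edges of $T_2$ at $o_0$ (on $\overline{o_0m}$ this is $m$). Coordinates are translated so that the apex is the origin. Let $\widehat K=\{(\lambda_1,\lambda_2):\lambda_1,\lambda_2\ge0,\ \lambda_1+\lambda_2\le1\}$ and $x(\lambda)=(1-\lambda_1-\lambda_2)p+\lambda_1q+\lambda_2r$. Let $\alpha(\lambda)>0$ be the unique number such that $\alpha(\lambda)x(\lambda)\in S$ and $F(\alpha(\lambda)x(\lambda))=0$, and set $z(\lambda)=\alpha(\lambda)x(\lambda)$. *)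

(* Defs.v *)
From HB Require Import structures.
From mathcomp Require Import all_boot all_order all_algebra.
From mathcomp Require Import perm.
From mathcomp Require Import all_classical all_reals all_analysis.

Set Implicit Arguments.
Unset Strict Implicit.
Unset Printing Implicit Defensive.

Import Order.TTheory GRing.Theory Num.Theory.
Import numFieldNormedType.Exports.

Local Open Scope classical_set_scope.
Local Open Scope ring_scope.

(* The library norm on row vectors is the sup norm, so the Euclidean structure
   is defined here; both norms induce the same topology and derivatives. *)
Section Euclid.
Context {R : realType} {m : nat}.
Implicit Types (u v : 'rV[R]_m) (A : set 'rV[R]_m).

Definition dotv u v : R := \sum_i u 0 i * v 0 i.

Definition enorm u : R := Num.sqrt (dotv u u).

Definition edist_to A u : R := inf [set enorm (u - y) | y in A].

Definition ediam A : R := sup [set enorm (w.1 - w.2) | w in A `*` A].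

Definition inradius A : R :=
  sup [set rho | 0 <= rho /\
    exists c, [set x | enorm (x - c) <= rho] `<=` A].

Definition hull (s : seq 'rV[R]_m) : set 'rV[R]_m :=
  [set x | exists w : 'I_(size s) -> R,
    [/\ forall j, 0 <= w j, \sum_j w j = 1 & x = \sum_j w j *: s`_j]].

Definition closest_point A u y :=
  A y /\ forall y', A y' -> enorm (u - y) <= enorm (u - y').

(* Extended-real valued, so that an unbounded set of radii gives +oo and not
   the default value of sup. *)
Definition reach A : \bar R :=
  ereal_sup [set r%:E | r in [set r | 0 < r /\
    forall u, edist_to A u < r -> exists! y, closest_point A u y]].

End Euclid.

Section Partials.
Context {R : realType} {m : nat} {V : normedModType R}.
Implicit Types (f : 'rV[R]_m.+1 -> V) (U : set 'rV[R]_m.+1)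
  (s : seq 'I_m.+1).

Definition partial (i : 'I_m.+1) f : 'rV[R]_m.+1 -> V :=
  fun x => 'D_(delta_mx 0 i) f x.

(* partials [:: i1; ...; ik] f = d_i1 (... (d_ik f)). *)
Definition partials s f : 'rV[R]_m.+1 -> V := foldr partial f s.

(* 'D_v f x has a default value when f is not derivable; this says that every
   derivative taken in partials s f exists at all points of U. *)
Fixpoint has_partials U s f : Prop :=
  if s is i :: t then
    has_partials U t f /\
    forall x, U x -> derivable (partials t f) x (delta_mx 0 i)
  else True.

Definition smooth f :=
  forall s, has_partials setT s f /\ continuous (partials s f).

(* The derivative up to the boundary of a set K that is the closure of its
   interior: the continuous extension g to K of the derivative in K°. *)
Definition is_partials_upto (K : set 'rV[R]_m.+1) s f (g : 'rV[R]_m.+1 -> V) :=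
  [/\ has_partials K° s f,
      forall x, K° x -> g x = partials s f x &
      {within K, continuous g}].

End Partials.

Section Surface.
Context {R : realType}.
Implicit Types (F : 'rV[R]_3 -> R) (x z v : 'rV[R]_3).

Definition zero_set F : set 'rV[R]_3 := [set x | F x = 0].

Definition grad F x : 'rV[R]_3 := \row_i partial i F x.

Record regular_level_set F : Prop := RegularLevelSet {
  level_smooth : smooth F;
  level_bounded : forall s : seq 'I_3, exists U : set 'rV[R]_3,
    [/\ open U, zero_set F `<=` U &
        exists M : R, forall x, U x -> `|partials s F x| <= M];
  level_compact : compact (zero_set F);
  level_regular : forall x, zero_set F x -> grad F x != 0
}.

Definition unit_normal F x : 'rV[R]_3 := (enorm (grad F x))^-1 *: grad F x.

(* Eigenvalues of the Weingarten map, the differential of the normal acting on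
   the tangent plane; the sign convention is irrelevant for max_curvature. *)
Definition principal_curvature F z (kappa : R) :=
  exists v, [/\ v != 0, dotv (unit_normal F z) v = 0 &
                'D_v (unit_normal F) z = kappa *: v].

Definition max_curvature F : R :=
  sup [set k | exists z kappa,
    [/\ zero_set F z, principal_curvature F z kappa & k = `|kappa|]].

End Surface.

(* The four vertices of a tetrahedron, in some order. *)
Definition tetra (R : realType) := {ffun 'I_4 -> 'rV[R]_3}.

Section Mesh.
Context {R : realType}.
Implicit Types (T : tetra R) (F : 'rV[R]_3 -> R) (M : seq (tetra R)).

Definition body T : set 'rV[R]_3 := hull (codom T).

Definition nondegenerate T :=
  row_free (\matrix_(k < 3) (T (lift ord0 k) - T ord0)).

Definition size_of T : R := ediam (body T).

(* Two elements meet exactly in the simplex spanned by their common vertices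
   (which may be empty). *)
Definition conforming_mesh M :=
  (forall T, T \in M -> nondegenerate T) /\
  (forall T1 T2, T1 \in M -> T2 \in M ->
     body T1 `&` body T2 = hull [seq v <- codom T1 | v \in codom T2]).

Definition shape_regular (sigma : R) M :=
  forall T, T \in M -> size_of T <= sigma * inradius (body T).

Definition quasi_uniform (tau : R) M :=
  forall T1 T2, T1 \in M -> T2 \in M -> size_of T1 <= tau * size_of T2.

Definition is_cut F T := body T `&` zero_set F !=set0.

Definition consistent F (c0 : R) T :=
  [/\ ((size_of T)%:E < reach (zero_set F))%E,
      size_of T * max_curvature F <= 1 / 4 &
      forall k, Num.max (c0 * size_of T) (max_curvature F * size_of T ^+ 2)
                < edist_to (zero_set F) (T k)].

Definition transverse F (c2 : R) T (a : 'rV[R]_3) :=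
  forall z, body T z -> zero_set F z ->
    c2 <= `|dotv (unit_normal F z) ((enorm (a - z))^-1 *: (a - z))|.

End Mesh.

Section Charts.
Context {R : realType}.
Implicit Types (F : 'rV[R]_3 -> R) (o : 'I_4 -> 'rV[R]_3)
  (a e p q r : 'rV[R]_3).

Definition one_three F o :=
  [/\ F (o 0) * F (o 1) < 0, F (o 0) * F (o 2) < 0 & F (o 0) * F (o 3) < 0].

Definition two_two F o :=
  [/\ 0 < F (o 0) * F (o 1), 0 < F (o 2) * F (o 3) & F (o 0) * F (o 2) < 0].

(* chart F o a e1 e2 e3: the piece S = conv {a, e1, e2, e3} of the tetrahedron
   with labelled vertices o is used with apex a; the remaining vertices may be
   listed in any order. *)
Inductive chart F o a e1 e2 e3 : Prop :=
| Chart_one of one_three F o & a = o 0 &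
    perm_eq [:: e1; e2; e3] [:: o 1; o 2; o 3]
| Chart_two1 m of two_two F o & hull [:: o 1; o 2] `&` zero_set F = [set m] &
    a = o 3 & perm_eq [:: e1; e2; e3] [:: o 0; o 1; m]
| Chart_two2 m of two_two F o & hull [:: o 1; o 2] `&` zero_set F = [set m] &
    a = o 0 & perm_eq [:: e1; e2; e3] [:: o 2; o 3; m].

Definition Khat : set 'rV[R]_2 :=
  [set l | [/\ 0 <= l 0 0, 0 <= l 0 1 & l 0 0 + l 0 1 <= 1]].

(* The flat triangle, in coordinates translated so that the apex a is 0. *)
Definition flat_param a p q r (l : 'rV[R]_2) : 'rV[R]_3 :=
  (1 - l 0 0 - l 0 1) *: (p - a) + l 0 0 *: (q - a) + l 0 1 *: (r - a).

(* t is a positive number for which t x(l) lies in S and on the surface, both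
   translated by the apex. *)
Definition ray_hits F a e1 e2 e3 p q r (l : 'rV[R]_2) (t : R) :=
  [/\ 0 < t, hull [:: a; e1; e2; e3] (a + t *: flat_param a p q r l) &
      zero_set F (a + t *: flat_param a p q r l)].

Definition surface_param a p q r (alpha : 'rV[R]_2 -> R) (l : 'rV[R]_2) :
    'rV[R]_3 :=
  alpha l *: flat_param a p q r l.

End Charts.

Definition multi_index (nu1 nu2 : nat) : seq 'I_2 :=
  nseq nu1 0 ++ nseq nu2 1.

(* Main.v *)
Require Import Defs.
From HB Require Import structures.
From mathcomp Require Import all_boot all_order all_algebra.
From mathcomp Require Import perm.
From mathcomp Require Import all_classical all_reals all_analysis.
From mathcomp Require Import ring lra zify.
Import Order.TTheory GRing.Theory Num.Theory.
Import numFieldNormedType.Exports.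
Local Open Scope classical_set_scope.
Local Open Scope ring_scope.

(** Write X(l) for the flat parametrization seen from the apex a, z = alpha X and
    y = a + z.  Since F(y(l)) = 0, implicit differentiation gives
      d_j alpha = - alpha^2 (grad F(y) . d_j X) / (grad F(y) . z).
    Let s = |p - a|.  The denominator has size s because the rays cross the
    surface transversally, and the numerator is O(s^2) because d_j X joins two
    points of the surface at distance O(s) from y ([grad_secant]).  So a first
    derivative of alpha is O(s).

    The exponent floor(n/2) + 1 comes from a bookkeeping of weights: a function
    has weight w if it is O(s^floor(w/2)) and its first derivatives have weight
    w + 1, so that every second derivative gains a factor s ([graded]).
    Rounding costs at most one unit in a product, which has weight w1 + w2 - 1
    ([graded_scale]).  In these terms X/s has weight 0; if alpha has weight 1,
    then z has weight 2, the derivatives of F at y have weight 1, the numerator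
    divided by s has weight 2 (its value is O(s) by tangency, its derivatives
    have weight 3), and the denominator divided by s has weight 1, since the
    term grad F(y) . d_j z of its derivative vanishes with F along y.  The
    formula then gives d_j alpha weight 2, which is what weight 1 for alpha
    asks of one more derivative ([graded_alpha], by induction on the number of
    derivatives).  Weight 2 of z is the theorem, as s <= h.

    All functions are families indexed by the admissible charts, so a constant
    in a bound is independent of the mesh by construction.  What remains is the
    geometry of one chart ([chart_bounds]).  The size s may be much smaller than
    h, but it is comparable with the distance from a to any point z of the
    surface piece: transversality and tangency give
      kappa |z| <= G |z'| + C |z - z'|^2
    for two such points, so |z| is at most L |z'| or at least a fixed eta, and a
    jump is impossible because z depends continuously on a connected parameter
    ([comparable_radii]).  Shape regularity enters through the ball inscribed
    in T: the affine functional that is 0 at a vertex and 1 on the opposite face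
    has gradient O(1/h) ([cone_functional]).  It keeps X away from the apex, so
    that alpha is bounded, and it bounds below the angle between two edges at
    the apex, so that s is bounded in terms of the diameter of the surface.
    Finally alpha is continuous up to the boundary of the parameter triangle
    because its graph is closed and bounded ([alpha_cvg]); it is differentiable
    in the interior by the implicit equation ([alpha_derive]), and the formula
    for its derivative carries continuity to all higher derivatives. *)

Set Implicit Arguments.
Unset Strict Implicit.
Unset Printing Implicit Defensive.

(** * The sup norm and the mean value theorem in coordinates *)

Section SupNorm.
Context {R : realType} {m : nat}.
Implicit Types u v : 'rV[R]_m.

Lemma ler_coord u i : `|u 0 i| <= `|u|.
Proof.
rewrite [leRHS]/Num.Def.normr/= mx_normrE.
exact: (le_bigmax _ (fun j : 'I_1 * 'I_m => `|u j.1 j.2|) (0, i)).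
Qed.

Lemma ler_rVnorm u c : 0 <= c -> (forall i, `|u 0 i| <= c) -> `|u| <= c.
Proof.
move=> c0 uc; rewrite [leLHS]/Num.Def.normr/= mx_normrE.
by apply: bigmax_le => // -[i j] _ /=; rewrite ord1.
Qed.

Lemma ler_dotv u v : `|dotv u v| <= m%:R * `|u| * `|v|.
Proof.
rewrite /dotv; apply: (le_trans (ler_norm_sum _ _ _)).
apply: (@le_trans _ _ (\sum_(i < m) `|u| * `|v|)).
  by apply: ler_sum => i _; rewrite normrM ler_pM // ler_coord.
by rewrite sumr_const card_ord -[_ *+ m]mulr_natl mulrA.
Qed.

Lemma dotvC u v : dotv u v = dotv v u.
Proof. by apply: eq_bigr => i _; rewrite mulrC. Qed.

Lemma dotvDr u v w : dotv u (v + w) = dotv u v + dotv u w.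
Proof. by rewrite -big_split; apply: eq_bigr => i _; rewrite mxE mulrDr. Qed.

Lemma dotvZr k u v : dotv u (k *: v) = k * dotv u v.
Proof. by rewrite mulr_sumr; apply: eq_bigr => i _; rewrite mxE mulrCA. Qed.

Lemma dotvNr u v : dotv u (- v) = - dotv u v.
Proof. by rewrite -scaleN1r dotvZr mulN1r. Qed.

Lemma dotvZl k u v : dotv (k *: u) v = k * dotv u v.
Proof. by rewrite dotvC dotvZr dotvC. Qed.

Lemma dotvNl u v : dotv (- u) v = - dotv u v.
Proof. by rewrite dotvC dotvNr dotvC. Qed.

Lemma dotv_ge0 u : 0 <= dotv u u.
Proof. by apply: sumr_ge0 => i _; rewrite -expr2 sqr_ge0. Qed.

Lemma ler_enorm u : `|u| <= enorm u.
Proof.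
apply: ler_rVnorm => [|i]; first exact: sqrtr_ge0.
rewrite -sqrtr_sqr ler_wsqrtr // /dotv (bigD1 i) //= -expr2 lerDl.
by apply: sumr_ge0 => j _; rewrite -expr2 sqr_ge0.
Qed.

Lemma enorm_le u : enorm u <= m%:R * `|u|.
Proof.
have m0 : 0 <= m%:R * `|u| by rewrite mulr_ge0.
rewrite -(ger0_norm m0) -sqrtr_sqr ler_wsqrtr //.
have := ler_dotv u u; rewrite ger0_norm ?dotv_ge0 // => /le_trans; apply.
rewrite exprMn -mulrA -expr2 ler_wpM2r ?sqr_ge0 //.
by case: (m) => [|k]; rewrite ?expr0n // expr2 ler_peMr ?ler0n // ler1n.
Qed.

End SupNorm.

Lemma is_derive_quotientP {R : realType} {V W : normedModType R}
    (f : V -> W) x v d :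
  (fun h : R => h^-1 *: (f (h *: v + x) - f x)) @ 0^' --> d <->
  is_derive x v f d.
Proof.
split=> [fd|[fx <-]]; last exact: fx.
apply: DeriveDef; last exact: (cvg_lim _ fd).
by apply/cvg_ex; exists d.
Qed.

Section MeanValue.
Context {R : realType} {m : nat}.
Variable f : 'rV[R]_m.+1 -> R.
Hypothesis fd : forall (i : 'I_m.+1) (x : 'rV[R]_m.+1), derivable f x (delta_mx 0 i).

Lemma mean_value_axis i x (t : R) : exists2 th : R, `|th| <= `|t| &
  f (x + t *: delta_mx 0 i) - f x =
    t * partial i f (x + th *: delta_mx 0 i).
Proof.
set e := delta_mx 0 i; pose g (u : R) := f (x + u *: e).
have dg (u : R) : is_derive u (1 : R) g (partial i f (x + u *: e)).
  apply/is_derive_quotientP.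
  have /derivableP/is_derive_quotientP := @fd i (x + u *: e).
  apply: cvg_trans; apply: near_eq_cvg; near=> h.
  by rewrite /g -[h *: (1 : R)]/(h * 1) mulr1 scalerDl addrCA.
have cg (a b : R) : {within `[a, b], continuous g}.
  apply: derivable_within_continuous => u _; exact: (@ex_derive _ _ _ _ _ _ _ (dg u)).
case: (leP 0 t) => t0.
  have [th + e1] := @MVT_segment _ g _ 0 t t0 (fun u _ => dg u) (cg _ _).
  rewrite in_itv /= => /andP[th0 tht]; exists th.
    by rewrite !ger0_norm.
  by rewrite mulrC -[in RHS](subr0 t) -e1 /g scale0r addr0.
have [th + e1] := @MVT_segment _ g _ t 0 (ltW t0) (fun u _ => dg u) (cg _ _).
rewrite in_itv /= => /andP[th0 tht]; exists th.
  by rewrite (ler0_norm tht) (ltr0_norm t0) lerN2.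
move: e1; rewrite /g scale0r addr0 sub0r => e1.
by rewrite -[LHS]opprB e1 mulrN opprK mulrC.
Unshelve. all: by end_near. Qed.

(** Changing one coordinate at a time turns an increment of f into a sum of
    one-dimensional increments, each with its own mean value point; the
    estimates below use only that these points are within |v| of x. *)
Lemma mean_value x v : exists2 xi : 'I_m.+1 -> 'rV[R]_m.+1,
  (forall i, `|xi i - x| <= `|v|) &
  f (x + v) - f x = \sum_i v 0 i * partial i f (xi i).
Proof.
pose tr k : 'rV[R]_m.+1 := \row_j (if (j < k)%N then v 0 j else 0).
have trS (i : 'I_m.+1) : tr i.+1 = tr i + v 0 i *: delta_mx 0 i.
  apply/rowP => j; rewrite !mxE eqxx /= ltnS leq_eqVlt.
  case: (eqVneq j i) => [->|ji].
    by rewrite eqxx ltnn /= add0r mulr1.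
  by rewrite (negbTE (ji : (j : nat) != i)) /= mulr0 addr0.
have /choice[xi xiP] (i : 'I_m.+1) : exists y, `|y - x| <= `|v| /\
    f (x + tr i.+1) - f (x + tr i) = v 0 i * partial i f y.
  have [th tht e1] := mean_value_axis i (x + tr i) (v 0 i).
  exists (x + tr i + th *: delta_mx 0 i); split; last by rewrite -e1 trS addrA.
  rewrite -(addrA x) [x + _]addrC addrK.
  apply: ler_rVnorm => // j; rewrite !mxE eqxx /=.
  case: (eqVneq j i) => [->|ji].
    by rewrite ltnn add0r mulr1 (le_trans tht) // ler_coord.
  by rewrite mulr0 addr0; case: ifP => _; rewrite ?normr0 // ler_coord.
exists xi => [i|]; first by case: (xiP i).
under eq_bigr do rewrite -(proj2 (xiP _)).
rewrite -(big_mkord xpredT (fun i => f (x + tr i.+1) - f (x + tr i))).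
rewrite telescope_sumr //; congr (f _ - f _).
  by congr (x + _); apply/rowP => j; rewrite mxE ltn_ord.
by rewrite -[LHS]addr0; congr (x + _); apply/rowP => j; rewrite !mxE.
Qed.

End MeanValue.

(** * Directional derivatives and the chain rule *)

Section Limits.
Context {R : realType} {T : Type} (F : set_system T) {FF : Filter F}.

Lemma cvg_coord m (u : T -> 'rV[R]_m) (a : 'rV[R]_m) i :
  u x @[x --> F] --> a -> u x 0 i @[x --> F] --> a 0 i.
Proof.
move=> /cvgrPdist_le ua; apply/cvgrPdist_le => e e0; near=> x.
have /(le_trans _) : `|a - u x| <= e by near: x; exact: ua.
by apply; have := ler_coord (a - u x) i; rewrite !mxE.
Unshelve. all: by end_near. Qed.

Lemma cvg_dotv m (u v : T -> 'rV[R]_m) (a b : 'rV[R]_m) :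
  u x @[x --> F] --> a -> v x @[x --> F] --> b ->
  dotv (u x) (v x) @[x --> F] --> dotv a b.
Proof.
move=> ua vb; apply: cvg_big => [|i _]; first exact: add_continuous.
apply: cvgM.
  exact: cvg_coord ua.
exact: cvg_coord vb.
Qed.

Lemma cvg_rV m (u : T -> 'rV[R]_m) (a : 'rV[R]_m) :
  (forall i, u x 0 i @[x --> F] --> a 0 i) -> u x @[x --> F] --> a.
Proof.
move=> ua; apply/cvgrPdist_le => e e0; near=> x.
apply: ler_rVnorm => [|i]; first exact: ltW.
rewrite !mxE; move: i; near: x; apply: filter_forall => i.
exact: ((cvgrPdist_le _ _).1 (ua i)).
Unshelve. all: by end_near. Qed.

End Limits.

Section DirectionalDerivatives.
Context {R : realType} {U V : normedModType R}.

Lemma is_derive_cvg (f : U -> V) x v d :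
  is_derive x v f d -> f (h *: v + x) @[h --> (0 : R)^'] --> f x.
Proof.
move=> /is_derive_quotientP fd.
have : f x + h *: (h^-1 *: (f (h *: v + x) - f x)) @[h --> (0 : R)^']
    --> f x + (0 : R) *: d.
  apply: cvgD; first exact: cvg_cst.
  apply: cvgZ => //; apply: cvg_within_filter; exact: cvg_id.
rewrite scale0r addr0; apply: cvg_trans; apply: near_eq_cvg; near=> h.
have h0 : h != 0 by near: h; exact: nbhs_dnbhs_neq.
by rewrite scalerA divff // scale1r addrC subrK.
Unshelve. all: by end_near. Qed.

Lemma is_derive_scale (f : U -> R) (g : U -> V) x v df dg :
  is_derive x v f df -> is_derive x v g dg ->
  is_derive x v (fun y => f y *: g y) (df *: g x + f x *: dg).
Proof.
move=> fd gd; have gc := is_derive_cvg gd.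
move/is_derive_quotientP in fd; move/is_derive_quotientP in gd.
apply/is_derive_quotientP.
have q : (h^-1 * (f (h *: v + x) - f x)) *: g (h *: v + x) +
    f x *: (h^-1 *: (g (h *: v + x) - g x)) @[h --> (0 : R)^']
    --> df *: g x + f x *: dg.
  by apply: cvgD; apply: cvgZ => //; exact: cvg_cst.
apply: cvg_trans q; apply: near_eq_cvg; near=> h => /=.
rewrite -scalerA (scalerA (f x)) [f x * _]mulrC -scalerA -scalerDr; congr (_ *: _).
by rewrite scalerBl scalerBr addrA subrK.
Unshelve. all: by end_near. Qed.

End DirectionalDerivatives.

Section ChainRule.
Context {R : realType} {m : nat} {V : normedModType R}.
Variable f : 'rV[R]_m.+1 -> R.
Hypothesis fd : forall (i : 'I_m.+1) (x : 'rV[R]_m.+1), derivable f x (delta_mx 0 i).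
Hypothesis fc : forall i, continuous (partial i f).

(** Caratheodory's form of differentiability: the increment is an exact scalar
    product with a vector that tends to the gradient.  With it the implicit
    derivative of [alpha_derive] is an exact quotient before any limit. *)
Lemma slope_vector (x : 'rV[R]_m.+1) : exists2 M : 'rV[R]_m.+1 -> 'rV[R]_m.+1,
  (forall v, f (x + v) - f x = dotv (M v) v) &
  M v @[v --> (0 : 'rV[R]_m.+1)] --> \row_i partial i f x.
Proof.
have /choice[xi xiP] v : exists y : 'I_m.+1 -> 'rV[R]_m.+1,
    (forall i, `|y i - x| <= `|v|) /\
    f (x + v) - f x = \sum_i v 0 i * partial i f (y i).
  by have [y] := mean_value fd x v; exists y.
exists (fun v => \row_i partial i f (xi v i)).
  move=> v; rewrite (proj2 (xiP v)).
  by apply: eq_bigr => i _; rewrite mxE mulrC.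
apply: (@cvg_rV _ _ _ (nbhs_filter (0 : 'rV[R]_m.+1))) => i; rewrite mxE.
under eq_fun do rewrite mxE.
apply: (@cvg_comp _ _ _ (fun v => xi v i) (partial i f) _ (nbhs x)); last exact: fc.
apply/cvgrPdist_le => e e0; apply/nbhs_ballP; exists e => //= v.
rewrite -ball_normE /= sub0r normrN distrC => ve.
exact: le_trans (proj1 (xiP v) i) (ltW ve).
Qed.

Lemma is_derive_chain (y : V -> 'rV[R]_m.+1) x v dy :
  is_derive x v y dy ->
  is_derive x v (f \o y) (dotv (\row_i partial i f (y x)) dy).
Proof.
move=> yd; have yc := is_derive_cvg yd.
have [M fM Mc] := slope_vector (y x).
apply/is_derive_quotientP; move/is_derive_quotientP in yd.
have Mh : M (y (h *: v + x) - y x) @[h --> (0 : R)^'] --> \row_i partial i f (y x).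
  apply: (@cvg_comp _ _ _ (fun h => y (h *: v + x) - y x) M _ (nbhs (0 : 'rV[R]_m.+1)) _ _ Mc).
  by rewrite -(subrr (y x)); apply: cvgB => //; exact: cvg_cst.
have q : dotv (M (y (h *: v + x) - y x)) (h^-1 *: (y (h *: v + x) - y x))
    @[h --> (0 : R)^'] --> dotv (\row_i partial i f (y x)) dy.
  exact: cvg_dotv Mh yd.
apply: cvg_trans q; apply: near_eq_cvg; near=> h => /=.
by rewrite dotvZr -fM [y x + _]addrC subrK.
Unshelve. all: by end_near. Qed.

End ChainRule.

(** * Families that gain half a power of s with each derivative *)

Lemma ord2_cases (i : 'I_2) : i = 0 \/ i = 1.
Proof. by case: i => [[|[|]]] // ?; [left|right]; exact: val_inj. Qed.

Section Graded.
Context {R : realType} {Om : Type} (s : Om -> R) (S : R).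
Hypothesis s_ge0 : forall om, 0 <= s om.
Hypothesis s_le : forall om, s om <= S.

(** The weight w counts half powers of s: the value is O(s ^ floor(w / 2)) and
    each derivative has weight w + 1.  The index set Om holds all charts, so the
    constants are uniform; N is the number of derivatives controlled. *)
Fixpoint graded (V : normedModType R) (N w : nat)
    (f : Om -> 'rV[R]_2 -> V) : Prop :=
  [/\ forall om l, Khat l -> f om x @[x --> within Khat (nbhs l)] --> f om l,
      exists C : R, forall om l, Khat l -> `|f om l| <= C * s om ^+ w./2 &
      if N is N'.+1 then
        forall j : 'I_2, exists2 g : Om -> 'rV[R]_2 -> V,
          (forall om l, Khat° l -> is_derive l (delta_mx 0 j) (f om) (g om l)) &
          graded N' w.+1 g
      else True].

Lemma graded_cvg (V : normedModType R) N w (f : Om -> 'rV[R]_2 -> V) :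
  graded N w f ->
  forall om l, Khat l -> f om x @[x --> within Khat (nbhs l)] --> f om l.
Proof. by case: N => [|N] []. Qed.

Lemma graded_bound (V : normedModType R) N w (f : Om -> 'rV[R]_2 -> V) :
  graded N w f -> exists2 C : R, 0 <= C &
  forall om l, Khat l -> `|f om l| <= C * s om ^+ w./2.
Proof.
move=> fg; have [C fC] : exists C : R, forall om l, Khat l ->
    `|f om l| <= C * s om ^+ w./2 by case: N fg => [|N] [].
exists `|C| => // om l /fC /le_trans; apply.
by rewrite ler_wpM2r ?exprn_ge0 // ler_norm.
Qed.

Lemma gradedW (V : normedModType R) N w (f : Om -> 'rV[R]_2 -> V) :
  graded N.+1 w f -> graded N w f.
Proof.
elim: N w f => [|N IHN] w f [fc fb fd]; split=> // j.
by have [g fg gd] := fd j; exists g => //; exact: IHN.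
Qed.

Lemma scale_weaken (C : R) a b om : 0 <= C -> (b <= a)%N ->
  C * s om ^+ a <= C * S ^+ (a - b) * s om ^+ b.
Proof.
move=> C0 ba; rewrite -mulrA ler_wpM2l // -[in leLHS](subnK ba) exprD.
by rewrite ler_wpM2r ?exprn_ge0 // lerXn2r ?nnegrE // (le_trans (s_ge0 om)).
Qed.

(** Lowering the weight uses that s is bounded above. *)
Lemma graded_le (V : normedModType R) N w w' (f : Om -> 'rV[R]_2 -> V) :
  (w' <= w)%N -> graded N w f -> graded N w' f.
Proof.
elim: N w w' f => [|N IHN] w w' f w'w fg;
  (split; [exact: (graded_cvg fg)|have [C C0 fC] := graded_bound fg;
   exists (C * S ^+ (w./2 - w'./2)) => om l /fC /le_trans; apply;
   exact: scale_weaken (half_leq w'w)|]) => // j.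
have [_ _ /(_ j)[g fdg gg]] := fg.
by exists g => //; apply: IHN gg.
Qed.

Lemma graded_add (V : normedModType R) N w (f g : Om -> 'rV[R]_2 -> V) :
  graded N w f -> graded N w g -> graded N w (fun om l => f om l + g om l).
Proof.
elim: N w f g => [|N IHN] w f g fg gg;
  (split; [move=> om l Kl; apply: cvgD; [exact: (graded_cvg fg)|exact: (graded_cvg gg)]
   |have [C C0 fC] := graded_bound fg; have [D D0 gD] := graded_bound gg;
   exists (C + D) => om l Kl; rewrite mulrDl (le_trans (ler_normD _ _)) //;
   rewrite lerD ?fC ?gD //|]) => // j.
have [_ _ /(_ j)[df fdf dfg]] := fg; have [_ _ /(_ j)[dg gdg dgg]] := gg.
exists (fun om l => df om l + dg om l); last exact: IHN.
by move=> om l Kl; apply: is_deriveD; [exact: fdf|exact: gdg].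
Qed.

Lemma graded_cst (V : normedModType R) N w (c : Om -> V) :
  (exists C : R, forall om, `|c om| <= C * s om ^+ w./2) ->
  graded N w (fun om _ => c om).
Proof.
elim: N w c => [|N IHN] w c [C cC];
  (split; [move=> *; exact: cvg_cst|by exists C|]) => // j.
exists (fun _ _ => 0) => [om l _|]; first exact: is_derive_cst.
by apply: IHN; exists 0 => om; rewrite normr0 mul0r.
Qed.

Lemma graded_sum (V : normedModType R) n N w (f : 'I_n -> Om -> 'rV[R]_2 -> V) :
  (forall i, graded N w (f i)) -> graded N w (fun om l => \sum_i f i om l).
Proof.
elim: n f => [|n IHn] f fg.
  under eq_fun => om do under eq_fun => l do rewrite big_ord0.
  by apply: graded_cst; exists 0 => om; rewrite normr0 mul0r.
under eq_fun => om do under eq_fun => l do rewrite big_ord_recl.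
by apply: graded_add; [exact: fg|apply: IHn => i; exact: fg].
Qed.

(** floor(w1/2) + floor(w2/2) >= floor((w1 + w2 - 1)/2), with equality unless
    both weights are even.  The rule w = w1 + w2 - 1 passes to derivatives,
    because differentiating either factor raises both sides by 1. *)
Lemma graded_scale (V : normedModType R) N w w1 w2
    (f : Om -> 'rV[R]_2 -> R) (g : Om -> 'rV[R]_2 -> V) :
  (w1 + w2 = w.+1)%N -> graded N w1 f -> graded N w2 g ->
  graded N w (fun om l => f om l *: g om l).
Proof.
elim: N w w1 w2 f g => [|N IHN] w w1 w2 f g ww fg gg;
  (split; [move=> om l Kl; apply: cvgZ; [exact: (graded_cvg fg)|exact: (graded_cvg gg)]
   |have [C C0 fC] := graded_bound fg; have [D D0 gD] := graded_bound gg;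
   exists (C * D * S ^+ (w1./2 + w2./2 - w./2)) => om l Kl;
   rewrite normrZ; apply: (@le_trans _ _ (C * D * s om ^+ (w1./2 + w2./2)));
     [by rewrite exprD mulrACA ler_pM ?fC ?gD|
      by apply: scale_weaken; [rewrite mulr_ge0|lia]]
   |]) => // j.
have [_ _ /(_ j)[df fdf dfg]] := fg; have [_ _ /(_ j)[dg gdg dgg]] := gg.
exists (fun om l => df om l *: g om l + f om l *: dg om l).
  by move=> om l Kl; apply: is_derive_scale; [exact: fdf|exact: gdg].
apply: graded_add.
  by apply: (IHN _ w1.+1 w2) => //; [rewrite addSn ww|exact: gradedW].
by apply: (IHN _ w1 w2.+1) => //; [rewrite addnS ww|exact: gradedW].
Qed.

Lemma graded_mul N w w1 w2 (f g : Om -> 'rV[R]_2 -> R) :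
  (w1 + w2 = w.+1)%N -> graded N w1 f -> graded N w2 g ->
  graded N w (fun om l => f om l * g om l).
Proof. exact: graded_scale. Qed.

Lemma graded_plus N w (f g : Om -> 'rV[R]_2 -> R) :
  graded N w f -> graded N w g -> graded N w (fun om l => f om l + g om l).
Proof. exact: graded_add. Qed.

Lemma graded_opp N w (f : Om -> 'rV[R]_2 -> R) :
  graded N w f -> graded N w (fun om l => - f om l).
Proof.
move=> fg; under eq_fun => om do under eq_fun => l do rewrite -mulN1r.
apply: (@graded_mul _ _ 1 w) => //.
by apply: graded_cst; exists 1 => om; rewrite normrN1 mulr1.
Qed.

Lemma Khat_coord_le1 (l : 'rV[R]_2) i : Khat l -> `|l 0 i| <= 1.
Proof.
case=> l0 l1 l01; have [->|->] := ord2_cases i.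
- by rewrite ger0_norm //; lra.
- by rewrite ger0_norm //; lra.
Qed.

Lemma graded_coord N i : graded N 0 (fun _ l => l 0 i : R).
Proof.
case: N => [|N]; (split; [move=> om l _; apply: cvg_within_filter; exact: coord_continuous
  |by exists 1 => om l /Khat_coord_le1; rewrite expr0 mulr1; apply|]) => // j.
exists (fun _ _ => (i == j)%:R).
  move=> om l _; apply/is_derive_quotientP.
  have q : (i == j)%:R @[h --> (0 : R)^'] --> ((i == j)%:R : R) by exact: cvg_cst.
  apply: cvg_trans q; apply: near_eq_cvg; near=> h; rewrite !mxE /= addrK /=.
  rewrite -[h^-1 *: _]/(h^-1 * _) mulrA mulVf ?mul1r //.
  by near: h; exact: nbhs_dnbhs_neq.
apply: graded_cst; exists 1 => om.
by rewrite expr0 mulr1 normr_nat lern1 leq_b1.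
Unshelve. all: by end_near. Qed.

(** Weight 1 is the weight of units: for f of size 1 with derivatives of weight
    2, the derivative - f^-2 df of the inverse again has weight 2. *)
Lemma graded_inv N (f : Om -> 'rV[R]_2 -> R) :
  (exists2 c : R, 0 < c & forall om l, Khat l -> c <= `|f om l|) ->
  graded N 1 f -> graded N 1 (fun om l => (f om l)^-1).
Proof.
move=> [c c0 cf]; have f0 om l : Khat l -> f om l != 0.
  by move=> /(cf om); rewrite -normr_gt0; exact: lt_le_trans.
elim: N => [|N IHN] fg;
  (split; [move=> om l Kl; apply: cvgV; [exact: f0|exact: (graded_cvg fg)]
   |exists c^-1 => om l Kl; rewrite mulr1 normfV lef_pV2 ?posrE ?normr_gt0 ?f0 //; exact: cf|])
  => // j.
have [_ _ /(_ j)[g fd gg]] := fg.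
exists (fun om l => - ((f om l)^-1 * (f om l)^-1 * g om l)).
  move=> om l Kl; have [fx <-] := fd om l Kl.
  have fl0 := f0 om l (interior_subset Kl).
  apply: DeriveDef; first exact: derivableV.
  by rewrite deriveV // -[- _ *: _]/(- _ * _) mulNr expr2 invfM.
have ig := IHN (gradedW fg).
by apply: graded_opp; apply: (@graded_mul _ _ 1 2) => //; apply: (@graded_mul _ _ 1 1).
Qed.

End Graded.

(** * Weights of the radial parametrization *)

Lemma is_derive_rV {R : realType} {U : normedModType R} m
    (f : U -> 'rV[R]_m) x v (d : 'I_m -> R) :
  (forall k, is_derive x v (fun u => f u 0 k) (d k)) ->
  is_derive x v f (\row_k d k).
Proof.
move=> fd; apply/is_derive_quotientP; apply: cvg_rV => k; rewrite mxE.
have /is_derive_quotientP q := fd k.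
apply: cvg_trans q; apply: near_eq_cvg; near=> h.
by rewrite !mxE.
Unshelve. all: by end_near. Qed.

(** What the geometry has to supply about one chart: s is its size, and M does
    not depend on the chart.  The last two bounds say that the rays cross the
    surface at a definite angle, and that the edges of the flat triangle are
    tangent to the surface up to an error of order s^2. *)
Record radial_bounds {R : realType} (F : 'rV[R]_3 -> R) (M s : R)
    (a p q r : 'rV[R]_3) (alpha : 'rV[R]_2 -> R) : Prop := RadialBounds {
  size_gt0 : 0 < s;
  size_le : s <= M;
  edges_le : [/\ `|p - a| <= M * s, `|q - a| <= M * s & `|r - a| <= M * s];
  ray_cvg : forall l, Khat l -> alpha x @[x --> within Khat (nbhs l)] --> alpha l;
  ray_le : forall l, Khat l -> `|alpha l| <= M;
  on_surface : forall l, Khat l -> F (a + surface_param a p q r alpha l) = 0;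
  transversality : forall l, Khat l -> s <= M *
    `|dotv (grad F (a + surface_param a p q r alpha l)) (surface_param a p q r alpha l)|;
  tangency : forall l x, Khat l -> x \in [:: q; r] ->
    `|dotv (grad F (a + surface_param a p q r alpha l)) (x - p)| <= M * s ^+ 2
}.

Section RadialChart.
Context {R : realType}.
Variable F : 'rV[R]_3 -> R.
Hypothesis F_smooth : smooth F.
Hypothesis partials_le : forall t : seq 'I_3, exists C : R,
  forall z, F z = 0 -> `|partials t F z| <= C.

Context {Om : Type}.
Variables (a p q r : Om -> 'rV[R]_3) (alpha : Om -> 'rV[R]_2 -> R).
Variables (s : Om -> R) (M : R).
Hypothesis bounds : forall om,
  radial_bounds F M (s om) (a om) (p om) (q om) (r om) (alpha om).

Let X om l := flat_param (a om) (p om) (q om) (r om) l.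
Let y om l := a om + alpha om l *: X om l.

(** The partial derivative of X in direction j, which is constant. *)
Let E om (j : 'I_2) := if j == 0 then q om - p om else r om - p om.

Let s_gt0 om : 0 < s om. Proof. exact: size_gt0 (bounds om). Qed.

Let s_le om : s om <= M. Proof. exact: size_le (bounds om). Qed.

Let alpha_cvg om l : Khat l ->
  alpha om x @[x --> within Khat (nbhs l)] --> alpha om l.
Proof. by case: (bounds om) => _ _ _ c _ _ _ _; exact: c. Qed.

Let y_zero om l : Khat l -> F (y om l) = 0.
Proof. move=> Kl; exact: (on_surface (bounds om) Kl). Qed.

Let grad_radial om l : Khat l ->
  s om <= M * `|dotv (grad F (y om l)) (alpha om l *: X om l)|.
Proof. move=> Kl; exact: (transversality (bounds om) Kl). Qed.

Let grad_tangential om l j : Khat l ->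
  `|dotv (grad F (y om l)) (E om j)| <= M * s om ^+ 2.
Proof.
by move=> Kl; rewrite /E; case: ifP => _; apply: (tangency (bounds om) Kl _);
  rewrite !inE eqxx ?orbT.
Qed.

Let s_ge0 om : 0 <= s om. Proof. exact: ltW. Qed.

Let s_neq0 om : s om != 0. Proof. by rewrite gt_eqF. Qed.

Local Notation gr := (graded s).

Let phi t om l := partials t F (y om l).
Let xh (k : 'I_3) om l := X om l 0 k / s om.
Let zh (k : 'I_3) om l := alpha om l * xh k om l.

Let partials_derivable t (i : 'I_3) (x : 'rV[R]_3) :
  derivable (partials t F) x (delta_mx 0 i).
Proof. by have [[_ /(_ x I)]] := F_smooth (i :: t). Qed.

Let partials_cts t (i : 'I_3) : continuous (partial i (partials t F)).
Proof. by have [] := F_smooth (i :: t). Qed.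

Let graded_bounded N (c : Om -> R) (C : R) :
  (forall om, `|c om| <= C) -> gr N 1 (fun om _ => c om).
Proof. by move=> cC; apply: graded_cst => //; exists C => om; rewrite mulr1. Qed.

Let scaled_coord (v : Om -> 'rV[R]_3) (C : R) k : (forall om, `|v om| <= C * s om) ->
  forall om, `|v om 0 k / s om| <= C.
Proof.
move=> vC om; rewrite normrM normfV (gtr0_norm (s_gt0 om)) ler_pdivrMr //.
exact: le_trans (ler_coord _ _) (vC om).
Qed.

Let graded_scaled_edge N (v : Om -> 'rV[R]_3) (C : R) k :
  (forall om, `|v om| <= C * s om) -> gr N 1 (fun om _ => v om 0 k / s om).
Proof. by move=> vC; apply: graded_bounded; exact: scaled_coord. Qed.

Let E_le om j : `|E om j| <= (M + M) * s om.
Proof.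
have [pa_le qa_le ra_le] := edges_le (bounds om).
rewrite /E mulrDl; case: ifP => _.
  rewrite (_ : q om - p om = (q om - a om) - (p om - a om)); last by rewrite opprB addrA subrK.
  by rewrite (le_trans (ler_normB _ _)) // lerD.
rewrite (_ : r om - p om = (r om - a om) - (p om - a om)); last by rewrite opprB addrA subrK.
by rewrite (le_trans (ler_normB _ _)) // lerD.
Qed.

Lemma flat_param_affine om l :
  X om l = (p om - a om) + (l 0 0 *: E om 0 + l 0 1 *: E om 1).
Proof.
rewrite /X /E /flat_param /= !scalerBl scale1r !scalerBr.
by apply/rowP => k; rewrite !mxE; ring.
Qed.

Lemma graded_xh N k : gr N 0 (xh k).
Proof.
have -> : xh k = fun om l => (p om - a om) 0 k / s om +
   (l 0 0 * (E om 0 0 k / s om) + l 0 1 * (E om 1 0 k / s om)).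
  apply/funext => om; apply/funext => l.
  by rewrite /xh flat_param_affine !mxE; field.
have gE j : gr N 0 (fun om l => l 0 j * (E om j 0 k / s om)).
  apply: (graded_mul s_ge0 s_le (w1 := 0) (w2 := 1)) => //; first exact: graded_coord.
  exact: (@graded_scaled_edge _ (fun om => E om j) _ _ (fun om => E_le om j)).
apply: (graded_plus s_ge0); last exact: (graded_plus s_ge0).
apply: (graded_le s_ge0 s_le (w := 1)) => //.
apply: (@graded_scaled_edge _ (fun om => p om - a om) M) => om.
by have [] := edges_le (bounds om).
Qed.

Lemma graded_zh N k : gr N 1 alpha -> gr N 0 (zh k).
Proof.
by move=> ga; apply: (graded_mul s_ge0 s_le (w1 := 1) (w2 := 0)) => //; exact: graded_xh.
Qed.

Let graded_s N : gr N 3 (fun om _ => s om).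
Proof.
by apply: graded_cst => //; exists 1 => om; rewrite mul1r ger0_norm.
Qed.

Lemma y_coord om l k : y om l 0 k = a om 0 k + s om * zh k om l.
Proof. by rewrite /y /zh /xh !mxE mulrCA (mulrC (s om)) divfK. Qed.

Lemma graded_dzh N (j : 'I_2) : gr N.+1 1 alpha ->
  exists2 dzh : 'I_3 -> Om -> 'rV[R]_2 -> R, (forall k, gr N 1 (dzh k)) &
  forall om l, Khat° l ->
    (forall k, is_derive l (delta_mx 0 j) (zh k om) (dzh k om l)) /\
    is_derive l (delta_mx 0 j) (y om) (\row_k (s om * dzh k om l)).
Proof.
move=> ga; have /choice[dzh dzhP] k : exists g : Om -> 'rV[R]_2 -> R,
    gr N 1 g /\ forall om l, Khat° l -> is_derive l (delta_mx 0 j) (zh k om) (g om l).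
  have [_ _ /(_ j)[g gd gg]] := graded_zh k ga.
  by exists g.
exists dzh => [k|om l Kl]; first by have [] := dzhP k.
have dz k : is_derive l (delta_mx 0 j) (zh k om) (dzh k om l).
  by have [_] := dzhP k; exact.
split => //; apply: is_derive_rV => k.
under eq_fun do rewrite y_coord.
have := is_deriveD (is_derive_cst (a om 0 k) l (delta_mx 0 j)) (is_deriveZ (s om) (dz k)).
by rewrite add0r.
Qed.

(** Every derivative of a function of y brings a factor s, from dy. *)
Lemma phi_derive (j : 'I_2) t (dzh : 'I_3 -> Om -> 'rV[R]_2 -> R) om l :
  is_derive l (delta_mx 0 j) (y om) (\row_k (s om * dzh k om l)) ->
  is_derive l (delta_mx 0 j) (phi t om)
    (\sum_k phi (k :: t) om l * (s om * dzh k om l)).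
Proof.
move=> /(is_derive_chain (@partials_derivable t) (@partials_cts t)).
by congr is_derive; apply: eq_bigr => k _; rewrite !mxE.
Qed.

(** By the chain rule the derivative is a sum of products of some phi, of weight
    1, with s dzh, of weight 3; this exceeds the weight 2 asked for. *)
Lemma graded_phi N t : gr N 1 alpha -> gr N 1 (phi t).
Proof.
move=> ga; have cy t' om l : Khat l -> phi t' om x @[x --> within Khat (nbhs l)] --> phi t' om l.
  move=> Kl; apply: (@cvg_comp _ _ _ (y om) (partials t' F) _ (nbhs (y om l)));
    last by have [_] := F_smooth t'; exact.
  apply: cvgD; first exact: cvg_cst.
  apply: cvgZ; first exact: @alpha_cvg.
  apply: cvg_rV => k; have := graded_cvg (graded_xh 0 k).
  move=> /(_ om l Kl)/(cvgMl_tmp (a := s om)); rewrite /xh mulrC divfK //.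
  by under eq_fun do rewrite mulrC divfK //.
have by_ t' : exists C : R, forall om l, Khat l -> `|phi t' om l| <= C * s om ^+ 0.
  by have [C hC] := partials_le t'; exists C => om l Kl; rewrite mulr1 hC // y_zero.
elim: N t ga => [|N IHN] t ga; (split; [exact: cy|exact: by_|]) => // j.
have [dzh gd dd] := graded_dzh j ga.
exists (fun om l => \sum_k phi (k :: t) om l * (s om * dzh k om l)).
  by move=> om l Kl; have [_ yd] := dd om l Kl; exact: phi_derive yd.
apply: (graded_sum s_ge0) => k.
apply: (graded_le s_ge0 s_le (w := 3)) => //.
apply: (graded_mul s_ge0 s_le (w1 := 1) (w2 := 3)) => //.
  exact: IHN (gradedW ga).
exact: (graded_mul s_ge0 s_le (w1 := 3) (w2 := 1)).
Qed.

Let radial om l := \sum_k phi [:: k] om l * zh k om l.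

Let tangential (j : 'I_2) om l := \sum_k phi [:: k] om l * (E om j 0 k / s om).

Lemma radialE om l :
  radial om l = dotv (grad F (y om l)) (alpha om l *: X om l) / s om.
Proof.
rewrite /radial /dotv mulr_suml; apply: eq_bigr => k _.
by rewrite [grad _ _ 0 k]mxE [X in _ * X / _]mxE /zh /xh !mulrA.
Qed.

Lemma tangentialE j om l :
  tangential j om l = dotv (grad F (y om l)) (E om j) / s om.
Proof.
by rewrite /tangential /dotv mulr_suml; apply: eq_bigr => k _; rewrite [grad _ _ 0 k]mxE mulrA.
Qed.

Lemma radial_lower : exists2 c : R, 0 < c &
  forall om l, Khat l -> c <= `|radial om l|.
Proof.
exists (`|M| + 1)^-1 => [|om l Kl]; first by rewrite invr_gt0 ltr_pwDr.
rewrite -[leLHS]mul1r ler_pdivrMr ?ltr_pwDr // radialE normrM normfV.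
rewrite (gtr0_norm (s_gt0 om)) mulrAC ler_pdivlMr // mul1r.
apply: (le_trans (grad_radial _ Kl)); rewrite mulrC ler_wpM2l //.
by rewrite (le_trans (ler_norm M)) // lerDl.
Qed.

(** The sum is the derivative of F along y divided by s, and F vanishes along y. *)
Lemma grad_dzh0 (j : 'I_2) (dzh : 'I_3 -> Om -> 'rV[R]_2 -> R) om l :
  Khat° l -> is_derive l (delta_mx 0 j) (y om) (\row_k (s om * dzh k om l)) ->
  \sum_k phi [:: k] om l * dzh k om l = 0.
Proof.
move=> Kl yd; have Fd := phi_derive [::] yd.
have F0 : is_derive l (delta_mx 0 j) (phi [::] om) 0.
  apply: (near_eq_is_derive _ (is_derive_cst 0 l _)).
  by near=> x; rewrite /phi /= y_zero //; near: x; exact: Kl.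
apply: (mulfI (s_neq0 om)); rewrite mulr0 mulr_sumr.
transitivity ('D_(delta_mx 0 j) (phi [::] om) l); last first.
  exact: (@derive_val _ _ _ _ _ _ _ F0).
rewrite (@derive_val _ _ _ _ _ _ _ Fd).
by apply: eq_bigr => k _; rewrite mulrCA.
Unshelve. all: by end_near. Qed.

(** Differentiating the sum of phi_k zh_k gives two sums; the one with the
    derivatives of zh is grad F . dy / s = 0, and the other one has weight 2.
    With both sums the weight would only be 1. *)
Lemma graded_radial N : gr N 1 alpha -> gr N 1 radial.
Proof.
move=> ga.
have term k : gr N 0 (fun om l => phi [:: k] om l * zh k om l).
  apply: (graded_mul s_ge0 s_le (w1 := 1) (w2 := 0)) => //.
    exact: graded_phi.
  exact: graded_zh.
have := graded_sum s_ge0 term.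
case: N {term} ga => [|N] ga [rc rb rd]; split => // j.
have [dzh gd dd] := graded_dzh j ga.
exists (fun om l => \sum_k (\sum_i phi [:: i; k] om l * (s om * dzh i om l)) * zh k om l).
  move=> om l Kl; have [zd yd] := dd om l Kl.
  have := is_derive_sum (fun k => is_derive_scale (phi_derive [:: k] yd) (zd k)).
  rewrite big_split /= (grad_dzh0 Kl yd) addr0.
  by congr is_derive; apply/funext => x; rewrite fct_sumE.
apply: (graded_sum s_ge0) => k.
apply: (graded_mul s_ge0 s_le (w1 := 3) (w2 := 0)) => //; last first.
  exact: gradedW (graded_zh _ ga).
apply: (graded_sum s_ge0) => i.
apply: (graded_mul s_ge0 s_le (w1 := 1) (w2 := 3)) => //.
  exact: graded_phi (gradedW ga).
exact: (graded_mul s_ge0 s_le (w1 := 3) (w2 := 1)).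
Qed.

(** The three factors alone give weight 1.  Weight 2 asks in addition for a
    value of order s, which is the tangency bound, and for derivatives of weight
    3, which is the factor s in dy. *)
Lemma graded_tangential N j : gr N 1 alpha -> gr N 2 (tangential j).
Proof.
move=> ga.
have gE N' k : gr N' 1 (fun om _ => E om j 0 k / s om).
  exact: (@graded_scaled_edge _ (fun om => E om j) _ _ (fun om => E_le om j)).
have term k : gr N 1 (fun om l => phi [:: k] om l * (E om j 0 k / s om)).
  apply: (graded_mul s_ge0 s_le (w1 := 1) (w2 := 1)) => //.
  exact: graded_phi.
have bound : exists C : R, forall om l, Khat l -> `|tangential j om l| <= C * s om ^+ 1.
  exists M => om l Kl; rewrite tangentialE normrM normfV (gtr0_norm (s_gt0 om)).
  by rewrite ler_pdivrMr // -mulrA -expr2 grad_tangential.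
have := graded_sum s_ge0 term.
case: N {term} ga => [|N] ga [rc _ rd]; split => // i.
have [dzh gd dd] := graded_dzh i ga.
exists (fun om l => \sum_k (\sum_i phi [:: i; k] om l * (s om * dzh i om l))
    * (E om j 0 k / s om)).
  move=> om l Kl; have [_ yd] := dd om l Kl.
  have := is_derive_sum (fun k => is_derive_scale (phi_derive [:: k] yd)
    (is_derive_cst (E om j 0 k / s om) l (delta_mx 0 i))).
  under [X in is_derive _ _ _ X]eq_bigr do rewrite scaler0 addr0.
  by congr is_derive; apply/funext => x; rewrite fct_sumE.
apply: (graded_sum s_ge0) => k.
apply: (graded_mul s_ge0 s_le (w1 := 3) (w2 := 1)) => //.
apply: (graded_sum s_ge0) => i'.
apply: (graded_mul s_ge0 s_le (w1 := 1) (w2 := 3)) => //.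
  exact: graded_phi (gradedW ga).
exact: (graded_mul s_ge0 s_le (w1 := 3) (w2 := 1)).
Qed.

Lemma flat_param_shift om l (j : 'I_2) (h : R) :
  X om (h *: delta_mx 0 j + l) = X om l + h *: E om j.
Proof.
rewrite !flat_param_affine; have [->|->] := ord2_cases j.
- by apply/rowP => k; rewrite !mxE /=; ring.
- by apply/rowP => k; rewrite !mxE /=; ring.
Qed.

(** From F(y(l + h e)) = F(y(l)) and a slope vector N of F at y(l), the increment
    of alpha divided by h equals - alpha(l + h e) (N . E) / (N . X); the continuity
    of alpha gives the limit. *)
Lemma alpha_derive (j : 'I_2) om l : Khat° l ->
  is_derive l (delta_mx 0 j) (alpha om)
    (- alpha om l * dotv (grad F (y om l)) (E om j) /
      dotv (grad F (y om l)) (X om l)).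
Proof.
move=> iKl; have Kl := interior_subset iKl.
set g := grad F (y om l); set e := delta_mx 0 j.
have gX0 : dotv g (X om l) != 0.
  apply/eqP => g0; have := @grad_radial om l Kl.
  by rewrite dotvZr -/g g0 mulr0 normr0 mulr0 leNgt s_gt0.
have [N FN Nc] := slope_vector (@partials_derivable [::]) (@partials_cts [::]) (y om l).
have lh : h *: e + l @[h --> (0 : R)^'] --> l.
  have lm : h *: e + l @[h --> (0 : R)^'] --> (0 : R) *: e + l.
    apply: cvgD; last exact: cvg_cst.
    by apply: cvgZr_tmp; apply: cvg_within_filter; exact: cvg_id.
  by move: lm; rewrite scale0r add0r.
have ah : alpha om (h *: e + l) @[h --> (0 : R)^'] --> alpha om l.
  apply: (@cvg_comp _ _ _ (fun h => h *: e + l) (alpha om) _ (nbhs l)) => //.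
  by have := @alpha_cvg om l Kl; rewrite within_interior.
have yh : y om (h *: e + l) - y om l @[h --> (0 : R)^'] --> (0 : 'rV[R]_3).
  have lm : a om + alpha om (h *: e + l) *: (X om l + h *: E om j) - y om l
      @[h --> (0 : R)^'] --> a om + alpha om l *: (X om l + (0 : R) *: E om j) - y om l.
    apply: cvgB; last exact: cvg_cst.
    apply: cvgD; first exact: cvg_cst.
    apply: cvgZ => //; apply: cvgD; first exact: cvg_cst.
    by apply: cvgZr_tmp; apply: cvg_within_filter; exact: cvg_id.
  move: lm; rewrite scale0r addr0 subrr.
  by under eq_fun do rewrite -flat_param_shift.
have Nh : N (y om (h *: e + l) - y om l) @[h --> (0 : R)^'] --> g.
  exact: (@cvg_comp _ _ _ (fun h => y om (h *: e + l) - y om l) N _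
    (nbhs (0 : 'rV[R]_3)) _ yh Nc).
have NX : dotv (N (y om (h *: e + l) - y om l)) (X om l) @[h --> (0 : R)^']
    --> dotv g (X om l) by apply: cvg_dotv => //; exact: cvg_cst.
have NE : dotv (N (y om (h *: e + l) - y om l)) (E om j) @[h --> (0 : R)^']
    --> dotv g (E om j) by apply: cvg_dotv => //; exact: cvg_cst.
have Kh : \forall h \near (0 : R)^', Khat (h *: e + l) by exact: (lh _ iKl).
have NX_neq0 := cvgr_neq0 _ NX gX0.
apply/is_derive_quotientP.
have lm : - alpha om (h *: e + l) * dotv (N (y om (h *: e + l) - y om l)) (E om j) /
    dotv (N (y om (h *: e + l) - y om l)) (X om l) @[h --> (0 : R)^'] -->
    - alpha om l * dotv g (E om j) / dotv g (X om l).
  apply: cvgM; last exact: cvgV.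
  by apply: cvgM => //; exact: cvgN.
apply: cvg_trans lm; apply: near_eq_cvg; near=> h.
have h0 : h != 0 by near: h; exact: nbhs_dnbhs_neq.
have Khl : Khat (h *: e + l) by near: h; exact: Kh.
have NX0 : dotv (N (y om (h *: e + l) - y om l)) (X om l) != 0.
  by near: h; exact: NX_neq0.
have := FN (y om (h *: e + l) - y om l).
rewrite [y om l + _]addrC subrK /= !y_zero // subrr.
set n := N _ in NX0 *; rewrite /y flat_param_shift.
set a' := alpha om (h *: e + l) in NX0 *.
rewrite opprD addrACA subrr add0r scalerDr -addrA dotvDr dotvDr dotvNr.
rewrite !dotvZr => e0.
have -> : a' - alpha om l = - a' * h * dotv n (E om j) / dotv n (X om l).
  by apply: (mulIf NX0); rewrite divfK // -[RHS]addr0 [in RHS]e0; ring.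
rewrite -[h^-1 *: _]/(h^-1 * _); field.
by rewrite NX0.
Unshelve. all: by end_near. Qed.

(** In d_j alpha = - alpha^2 (1 / radial) tangential the weights 1, 1, 1 and 2
    combine to 2, so control of N derivatives of alpha gives control of N + 1. *)
Lemma graded_alpha N : gr N 1 alpha.
Proof.
have bound : exists C : R, forall om l, Khat l -> `|alpha om l| <= C * s om ^+ 0.
  by exists M => om l Kl; rewrite mulr1; exact: (ray_le (bounds om) Kl).
elim: N => [|N IHN]; (split; [exact: @alpha_cvg|exact: bound|]) => // j.
exists (fun om l => - (alpha om l * alpha om l * (radial om l)^-1 *
    tangential j om l)).
  move=> om l iKl; have Kl := interior_subset iKl.
  have := @alpha_derive j om l iKl; congr is_derive.
  have gX0 : dotv (grad F (y om l)) (alpha om l *: X om l) != 0.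
    apply/eqP => g0; have := @grad_radial om l Kl.
    by rewrite g0 normr0 mulr0 leNgt s_gt0.
  rewrite radialE tangentialE; move: gX0; rewrite dotvZr mulf_eq0 negb_or => /andP[a0 X0].
  field.
  by rewrite a0 X0 s_neq0.
apply: (graded_opp s_ge0 s_le).
apply: (graded_mul s_ge0 s_le (w1 := 1) (w2 := 2)) => //; last exact: graded_tangential.
apply: (graded_mul s_ge0 s_le (w1 := 1) (w2 := 1)) => //.
  exact: (graded_mul s_ge0 s_le (w1 := 1) (w2 := 1)).
by apply: (graded_inv s_ge0 s_le); [exact: radial_lower|exact: graded_radial].
Qed.

Lemma graded_surface_param N :
  gr N 2 (fun om => surface_param (a om) (p om) (q om) (r om) (alpha om)).
Proof.
have -> : (fun om => surface_param (a om) (p om) (q om) (r om) (alpha om)) =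
    (fun om l => \sum_k (s om * zh k om l) *: (delta_mx 0 k : 'rV[R]_3)).
  apply/funext => om; apply/funext => l; rewrite [LHS]row_sum_delta.
  apply: eq_bigr => k _; congr (_ *: _).
  by rewrite /surface_param /zh /xh !mxE mulrCA (mulrC (s om)) divfK.
apply: (graded_sum s_ge0) => k.
apply: (graded_scale s_ge0 s_le (w1 := 2) (w2 := 1)) => //.
  apply: (graded_mul s_ge0 s_le (w1 := 3) (w2 := 0)) => //.
  exact: graded_zh (graded_alpha N).
apply: (@graded_cst _ _ _ _ _ _ (fun _ => delta_mx 0 k : 'rV[R]_3)).
exists 1 => om; rewrite mulr1; apply: ler_rVnorm => // i.
by rewrite mxE normr_nat lern1 leq_b1.
Qed.

End RadialChart.

(** * From weights to partial derivatives up to the boundary *)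

Section PartialsUpto.
Context {R : realType} {V : normedModType R}.
Implicit Types (f g : 'rV[R]_2 -> V) (U : set 'rV[R]_2) (t : seq 'I_2).

(** Iterated partial derivatives on an open set depend only on the values there;
    this lets a derivative known only in the interior stand in for [partial]. *)
Lemma partials_local U t f g : open U -> (forall x, U x -> f x = g x) ->
  (has_partials U t f -> has_partials U t g) /\
  forall x, U x -> partials t f x = partials t g x.
Proof.
move=> oU fg; elim: t => [|i t [IHd IHe]] //=.
have near_e x : U x -> \forall u \near x, partials t f u = partials t g u.
  by move=> Ux; apply: filterS IHe _; exact: open_nbhs_nbhs.
split=> [[ft fi]|x Ux]; last exact: near_eq_derive (near_e x Ux).
split=> [|x Ux]; first exact: IHd.
exact: near_eq_derivable (near_e x Ux) (fi x Ux).
Qed.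

Lemma has_partials_rcons U t j f :
  (forall x, U x -> derivable f x (delta_mx 0 j)) ->
  has_partials U t (partial j f) -> has_partials U (rcons t j) f.
Proof.
move=> fj; elim: t => [|i t IHt] //= [ft fi].
by split; [exact: IHt|rewrite /partials foldr_rcons].
Qed.

Lemma is_partials_upto_rcons K t j f g dz :
  (forall x, K° x -> is_derive x (delta_mx 0 j) f (g x)) ->
  is_partials_upto K t g dz -> is_partials_upto K (rcons t j) f dz.
Proof.
move=> fg [gt dzE dzc].
have oK : open K° by exact: open_interior.
have gE x : K° x -> g x = partial j f x.
  by move=> /fg d; rewrite /partial (@derive_val _ _ _ _ _ _ _ d).
have [gd ge] := partials_local t oK gE.
split=> // [|x Kx].
  apply: has_partials_rcons; last exact: gd.
  by move=> x /fg d; exact: (@ex_derive _ _ _ _ _ _ _ d).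
by rewrite dzE // ge // /partials foldr_rcons.
Qed.

(** A list of directions is applied from its last entry, so the induction peels
    off that end. *)
Lemma graded_partials_upto {Om : Type} (s : Om -> R) N w (f : Om -> 'rV[R]_2 -> V) :
  (forall om, 0 <= s om) -> graded s N w f ->
  exists C : R, forall t, size t = N -> forall om, exists2 dz,
    is_partials_upto Khat t (f om) dz &
    forall l, Khat l -> `|dz l| <= C * s om ^+ (w + N)./2.
Proof.
move=> s0; elim: N w f => [|N IHN] w f fg.
  have [C _ fC] := graded_bound s0 fg; exists C => t /size0nil -> om.
  exists (f om); last by rewrite addn0; exact: fC.
  by split=> //; apply/subspace_continuousP; exact: (graded_cvg fg).
have [_ _ fd] := fg.
have /choice[D DP] (j : 'I_2) : exists D : R, forall t, size t = N ->
    forall om, exists2 dz, is_partials_upto Khat (rcons t j) (f om) dz &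
    forall l, Khat l -> `|dz l| <= D * s om ^+ (w + N.+1)./2.
  have [g gd gg] := fd j; have [D DP] := IHN _ _ gg.
  exists D => t tN om; have [dz dzp dzb] := DP t tN om.
  by exists dz; [exact: is_partials_upto_rcons dzp|rewrite addnS -addSn].
exists (Num.max (D 0) (D 1)) => t; case/lastP: t => // t j.
rewrite size_rcons => -[tN] om; have [dz dzp dzb] := DP j t tN om.
exists dz => // l Kl; apply: (le_trans (dzb l Kl)); rewrite ler_wpM2r ?exprn_ge0 //.
by rewrite le_max; have [->|->] := ord2_cases j; rewrite lexx ?orbT.
Qed.

End PartialsUpto.

(** * Constants of the level set *)

Section LevelSet.
Context {R : realType}.
Variable F : 'rV[R]_3 -> R.
Hypothesis hF : regular_level_set F.

Let F_smooth : smooth F := level_smooth hF.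

Let partials_derivable t (i : 'I_3) (x : 'rV[R]_3) :
  derivable (partials t F) x (delta_mx 0 i).
Proof. by have [[_ /(_ x I)]] := F_smooth (i :: t). Qed.

Lemma level_set_bounded : exists2 D : R, 0 < D & forall z, F z = 0 -> `|z| <= D.
Proof.
have [M [_ MP]] := compact_bounded (level_compact hF).
exists (`|M| + 1) => [|z Fz]; first by rewrite ltr_pwDr.
by apply: MP => //; rewrite (le_lt_trans (ler_norm M)) // ltrDl.
Qed.

Lemma partials_bounded t (rho : R) : exists2 C : R, 0 <= C &
  forall x, `|x| <= rho -> `|partials t F x| <= C.
Proof.
pose B := [set x : 'rV[R]_3 | `|x| <= rho].
have cB : compact B.
  apply: bounded_closed_compact.
    by exists rho; split; [exact: num_real|move=> M rM x /= /le_trans; apply; exact: ltW].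
  have -> : B = closed_ball_ (fun x => `|x|) (0 : 'rV[R]_3) rho.
    by apply/seteqP; split=> x; rewrite /B /closed_ball_ /= sub0r normrN.
  exact: closed_closed_ball_.
have [_ pc] := F_smooth t.
have /compact_bounded[M [_ MP]] : compact (partials t F @` B).
  by apply: continuous_compact => //; apply: continuous_subspaceT => x; exact: pc.
exists (`|M| + 1) => // x xB; apply: MP; last by exists x.
by rewrite (le_lt_trans (ler_norm M)) // ltrDl.
Qed.

Lemma partials_bounded_level t : exists C : R,
  forall z, F z = 0 -> `|partials t F z| <= C.
Proof.
have [D _ zD] := level_set_bounded; have [C _ CP] := partials_bounded t D.
by exists C => z /zD; exact: CP.
Qed.

(** F z = F w, so the mean value points of the segment replace grad F z by
    differences of first derivatives, which are O(|w - z|).  Second derivatives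
    are needed on a ball of three times the radius of the level set, which holds
    all the mean value points. *)
Lemma grad_secant : exists2 C : R, 0 <= C &
  forall z w, F z = 0 -> F w = 0 ->
  `|dotv (grad F z) (w - z)| <= C * `|w - z| ^+ 2.
Proof.
have [D D0 zD] := level_set_bounded.
have /choice[C CP] (i : 'I_3) : exists C : R, forall j : 'I_3,
    0 <= C /\ forall x, `|x| <= D + (D + D) -> `|partials [:: j; i] F x| <= C.
  have /choice[c cP] (j : 'I_3) : exists c : R,
      0 <= c /\ forall x, `|x| <= D + (D + D) -> `|partials [:: j; i] F x| <= c.
    by have [c c0 cP] := partials_bounded [:: j; i] (D + (D + D)); exists c.
  exists (\sum_j c j) => j; have cj : c j <= \sum_j c j.
    by rewrite (bigD1 j) //= lerDl sumr_ge0 // => k _; have [] := cP k.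
  have [c0 cx] := cP j; split; first exact: le_trans cj.
  by move=> x /cx /le_trans; apply.
exists (\sum_i (C i *+ 3)) => [|z w Fz Fw].
  by apply: sumr_ge0 => i _; rewrite mulrn_wge0 //; have [] := CP i 0.
have [xi xiP e] := mean_value (@partials_derivable [::]) z (w - z).
move: e; rewrite [z + _]addrC subrK /= Fz Fw subrr => e.
have -> : dotv (grad F z) (w - z) =
    \sum_i (w - z) 0 i * (partial i F z - partial i F (xi i)).
  rewrite -[LHS]subr0 [X in _ - X]e -sumrB; apply: eq_bigr => i _.
  by rewrite [grad _ _ _ _]mxE mulrBr mulrC.
rewrite mulr_suml; apply: (le_trans (ler_norm_sum _ _ _)); apply: ler_sum => i _.
rewrite normrM expr2 mulrCA; apply: ler_pM => //; first exact: ler_coord.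
have [eta etaP e2] := mean_value (@partials_derivable [:: i]) z (xi i - z).
move: e2; rewrite [z + _]addrC subrK /= distrC => ->.
apply: (le_trans (ler_norm_sum _ _ _)).
apply: (@le_trans _ _ (\sum_(j < 3) C i * `|w - z|)); last first.
  by rewrite sumr_const card_ord mulrnAl.
apply: ler_sum => j _; rewrite normrM mulrC; apply: ler_pM => //; last first.
  exact: le_trans (ler_coord _ _) (xiP i).
have [_ CB] := CP i j; apply: CB.
rewrite -[eta j](subrK z) addrC (le_trans (ler_normD _ _)) // lerD ?zD //.
apply: (le_trans (etaP j)); apply: (le_trans (xiP i)).
by rewrite (le_trans (ler_normB _ _)) // lerD ?zD.
Qed.

Lemma grad_bounded : exists2 G : R, 0 < G & forall z, F z = 0 -> `|grad F z| <= G.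
Proof.
have /choice[c cP] (i : 'I_3) : exists c : R, forall z, F z = 0 -> `|partials [:: i] F z| <= c.
  exact: partials_bounded_level.
exists (1 + \sum_i `|c i|) => [|z Fz]; first by rewrite ltr_pwDl ?sumr_ge0.
apply: ler_rVnorm => [|i]; first by rewrite addr_ge0 ?sumr_ge0.
rewrite mxE (le_trans (cP i _ Fz)) // (bigD1 i) //= (le_trans (ler_norm _)) //.
by rewrite addrCA lerDl addr_ge0 ?sumr_ge0.
Qed.

(** 1 / |grad F| is continuous on the compact level set, hence bounded. *)
Lemma grad_lower : exists2 c : R, 0 < c & forall z, F z = 0 -> c <= `|grad F z|.
Proof.
have gc : continuous (fun z => `|grad F z|).
  move=> z; apply: (@cvg_comp _ _ _ (grad F) (fun u => `|u|) _ (nbhs (grad F z)));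
    last exact: norm_continuous.
  apply: (@cvg_rV _ _ _ (nbhs_filter z)) => i; rewrite mxE.
  under eq_fun do rewrite mxE.
  by have [_] := F_smooth [:: i]; exact.
have g0 z : zero_set F z -> `|grad F z| != 0.
  by move=> /(level_regular hF); rewrite normr_eq0.
have : compact ((fun z => `|grad F z|^-1) @` zero_set F).
  apply: continuous_compact; last exact: level_compact hF.
  apply/subspace_continuousP => z Fz; apply: cvg_within_filter.
  by apply: cvgV; [exact: g0|exact: gc].
move=> /compact_bounded[M [_ MP]].
exists (`|M| + 1)^-1 => [|z Fz]; first by rewrite invr_gt0 ltr_pwDr.
have gz : 0 < `|grad F z| by rewrite lt_neqAle eq_sym g0 /=.
rewrite -[leRHS]invrK lef_pV2 ?posrE ?invr_gt0 ?ltr_pwDr //.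
have := MP (`|M| + 1); rewrite (le_lt_trans (ler_norm M)) ?ltrDl //.
move=> /(_ isT (`|grad F z|^-1)) /=; rewrite normfV normr_id; apply.
by exists z.
Qed.

End LevelSet.

(** * Comparability of the distances from the apex *)

Section KhatTopology.
Context {R : realType}.
Implicit Types l : 'rV[R]_2.

Lemma Khat_segment l l' (u : R) : Khat l -> Khat l' -> 0 <= u <= 1 ->
  Khat (l + u *: (l' - l)).
Proof.
move=> [l0 l1 l01] [m0 m1 m01] /andP[u0 u1]; split; rewrite !mxE; nra.
Qed.

Lemma flat_param_cvg {T : Type} {G : set_system T} {FG : Filter G}
    (a p q r : 'rV[R]_3) (f : T -> 'rV[R]_2) (l : 'rV[R]_2) :
  f x @[x --> G] --> l ->
  flat_param a p q r (f x) @[x --> G] --> flat_param a p q r l.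
Proof.
rewrite /flat_param => fl; have f0 := cvg_coord fl (i := 0); have f1 := cvg_coord fl (i := 1).
apply: cvgD; last by apply: cvgZ; [exact: f1|exact: cvg_cst].
apply: cvgD; last by apply: cvgZ; [exact: f0|exact: cvg_cst].
apply: cvgZ; last exact: cvg_cst.
by apply: cvgB; [apply: cvgB; [exact: cvg_cst|exact: f0]|exact: f1].
Qed.

End KhatTopology.

Section Comparability.
Context {R : realType}.
Variables (z : 'rV[R]_2 -> 'rV[R]_3).
Hypothesis z_cvg : forall l, Khat l -> z x @[x --> within Khat (nbhs l)] --> z l.

Lemma Khat_IVT l l' v : Khat l -> Khat l' -> `|z l| <= v <= `|z l'| ->
  exists2 x, Khat x & `|z x| = v.
Proof.
move=> Kl Kl' vz; pose path (u : R) := l + u *: (l' - l).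
pose g (u : R) := `|z (path u)|.
have Kp u : u \in `[0, 1]%R -> Khat (path u).
  by rewrite in_itv /= => u01; exact: Khat_segment.
have gc : {within `[0, 1], continuous g}.
  apply/subspace_continuousP => u u01.
  apply: (@cvg_comp _ _ _ (z \o path) (fun x => `|x|) _ (nbhs (z (path u))));
    last exact: norm_continuous.
  apply: (@cvg_comp _ _ _ path z _ (within Khat (nbhs (path u)))); last exact: z_cvg (Kp u u01).
  have pc : path x @[x --> nbhs u] --> path u.
    by apply: cvgD; [exact: cvg_cst|apply: cvgZ; [exact: cvg_id|exact: cvg_cst]].
  move=> P nP; have nP' : nbhs u (fun x => Khat (path x) -> P (path x)) := pc _ nP.
  by apply: (filterS _ nP') => x /= Px x01; apply: Px; exact: Kp.
have g0 : g 0 = `|z l| by rewrite /g /path scale0r addr0.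
have g1 : g 1 = `|z l'| by rewrite /g /path scale1r addrC subrK.
have [|u u01 gu] := IVT ler01 gc (v := v).
  by rewrite g0 g1 ge_min le_max; case/andP: vz => -> ->; rewrite orbT.
by exists (path u) => //; exact: Kp.
Qed.

(** With m = |z l'| and L, eta as below, the hypothesis forces a value |z l| that
    lies between m and eta to be at most L m.  If L m < eta, values above L m
    would by continuity include one in the gap between L m and eta.  Otherwise
    m is bounded below and the bound D on the diameter suffices. *)
Lemma comparable_radii (kappa G C D : R) :
  0 < kappa -> 0 < G -> 0 <= C -> 0 < D ->
  (forall l l', Khat l -> Khat l' ->
     kappa * `|z l| <= G * `|z l'| + C * `|z l - z l'| ^+ 2) ->
  (forall l l', Khat l -> Khat l' -> `|z l - z l'| <= D) ->
  forall l l', Khat l -> Khat l' ->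
  `|z l| <= (1 + 2 * G / kappa + D * (1 + 2 * G / kappa) * (8 * C + 1) / kappa) * `|z l'|.
Proof.
move=> k0 G0 C0 D0 quad diam l l' Kl Kl'.
set L := 1 + 2 * G / kappa; set m := `|z l'|.
have GL : 0 < G / kappa by rewrite divr_gt0.
have L1 : 1 <= L by rewrite /L -mulrA; lra.
have m0 : 0 <= m by exact: normr_ge0.
(* So small that C (2 t)^2 <= kappa t / 2 for t <= eta. *)
pose eta := kappa / (8 * C + 1).
have C1 : 0 < 8 * C + 1 by lra.
have eta0 : 0 < eta by rewrite divr_gt0.
have Ceta : 8 * C * eta <= kappa.
  by rewrite /eta mulrA ler_pdivrMr //; nra.
have small t x : Khat x -> `|z x| = t -> m <= t -> t <= eta -> t <= L * m.
  move=> Kx zx mt te; have t0 : 0 <= t by rewrite -zx.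
  have h1 := quad _ _ Kx Kl'; rewrite zx -/m in h1.
  have h2 : `|z x - z l'| <= 2 * t.
    by rewrite (le_trans (ler_normB _ _)) // zx -/m; lra.
  have h3 : `|z x - z l'| ^+ 2 <= 4 * t * t.
    have -> : 4 * t * t = (2 * t) ^+ 2 by ring.
    by apply: lerXn2r h2; rewrite nnegrE ?mulr_ge0.
  have h4 : C * `|z x - z l'| ^+ 2 <= C * (4 * t * t) by rewrite ler_wpM2l.
  have h5 : C * (4 * t * t) <= kappa * t / 2.
    have : (8 * C * eta) * t <= kappa * t by rewrite ler_wpM2r.
    have : C * t * t <= C * eta * t by rewrite ler_wpM2r // ler_wpM2l.
    lra.
  have h6 : t <= 2 * (G / kappa) * m.
    rewrite -(ler_pM2l k0).
    have -> : kappa * (2 * (G / kappa) * m) = 2 * (G * m).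
      by field; rewrite gt_eqF.
    lra.
  by apply: (le_trans h6); rewrite /L; nra.
have bigL : D * L * (8 * C + 1) / kappa * m = D * L * m / eta.
  by rewrite /eta; field; rewrite !gt_eqF.
rewrite -/L mulrDl bigL.
case: (ltP (L * m) eta) => Lm.
  have : `|z l| <= L * m; last first.
    by move=> /le_trans; apply; rewrite lerDl divr_ge0 ?(ltW eta0) // !mulr_ge0 //; lra.
  rewrite leNgt; apply/negP => zl.
  pose v := Num.min `|z l| eta.
  have vL : L * m < v by rewrite /v lt_min zl Lm.
  have mv : m <= v by rewrite (le_trans _ (ltW vL)) // ler_peMl.
  have [x Kx zx] : exists2 x, Khat x & `|z x| = v.
    by apply: (Khat_IVT Kl' Kl); rewrite mv /v ge_min lexx.
  have := small _ _ Kx zx mv; rewrite {1}/v ge_min lexx orbT => /(_ isT).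
  by rewrite leNgt vL.
have zl : `|z l| <= m + D.
  rewrite -[z l](subrK (z l')) addrC (le_trans (ler_normD _ _)) //.
  by rewrite lerD // diam.
apply: (le_trans zl); apply: lerD; first by rewrite ler_peMl.
by rewrite -(mulrA D) -mulrA ler_peMr ?(ltW D0) // ler_pdivlMr // mul1r.
Qed.

End Comparability.

(** * Convex hulls and continuity of the ray parameter *)

Section Hulls.
Context {R : realType} {m : nat}.
Implicit Types (a e x : 'rV[R]_m) (s : seq 'rV[R]_m).

Lemma hull_segmentP a e x : hull [:: a; e] x <->
  exists2 t : R, 0 <= t <= 1 & x = a + t *: (e - a).
Proof.
split=> [[w [w0]]|[t /andP[t0 t1] ->]].
  rewrite !big_ord_recl !big_ord0 /= !addr0 => w1 ->.
  exists (w (lift ord0 ord0)).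
    by rewrite w0 /= -w1 lerDr w0.
  have -> : w ord0 = 1 - w (lift ord0 ord0) by rewrite -w1 addrK.
  by apply/rowP => k; rewrite !mxE; ring.
exists (fun j => nth 0 [:: 1 - t; t] j); split=> [j||].
- by case: j => [[|[|]]] //= _; rewrite subr_ge0.
- by rewrite !big_ord_recl !big_ord0 /=; ring.
- by rewrite !big_ord_recl !big_ord0 /=; apply/rowP => k; rewrite !mxE; ring.
Qed.

Lemma hull_tetraP a e1 e2 e3 x : hull [:: a; e1; e2; e3] x <->
  exists w1 w2 w3 : R, [/\ 0 <= w1, 0 <= w2, 0 <= w3, w1 + w2 + w3 <= 1 &
    x = a + (w1 *: (e1 - a) + w2 *: (e2 - a) + w3 *: (e3 - a))].
Proof.
split=> [[w [w0]]|[w1 [w2 [w3 [w10 w20 w30 w1' ->]]]]].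
  rewrite !big_ord_recl !big_ord0 /= !addr0.
  set w1 := w (lift ord0 ord0); set w2 := w (lift ord0 (lift ord0 ord0)).
  set w3 := w (lift ord0 (lift ord0 (lift ord0 ord0))) => w1' ->.
  have wa : w ord0 = 1 - w1 - w2 - w3 by rewrite -w1'; ring.
  exists w1, w2, w3; split; rewrite ?w0 //; first by have := w0 ord0; rewrite wa; lra.
  by rewrite wa; apply/rowP => k; rewrite !mxE; ring.
exists (fun j => nth 0 [:: 1 - (w1 + w2 + w3); w1; w2; w3] j); split=> [j||].
- by case: j => [[|[|[|[|]]]]] //= _; rewrite subr_ge0.
- by rewrite !big_ord_recl !big_ord0 /=; ring.
- by rewrite !big_ord_recl !big_ord0 /=; apply/rowP => k; rewrite !mxE; ring.
Qed.

Lemma hull_sub s s' : (forall x, x \in s -> hull s' x) -> hull s `<=` hull s'.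
Proof.
move=> ss' x [w [w0 w1 ->]].
have /choice[v vP] (j : 'I_(size s)) : exists v : 'I_(size s') -> R,
    [/\ forall k, 0 <= v k, \sum_k v k = 1 & s`_j = \sum_k v k *: s'`_k].
  by apply: ss'; rewrite mem_nth.
exists (fun k => \sum_j w j * v j k); split=> [k||].
- by apply: sumr_ge0 => j _; rewrite mulr_ge0 //; have [] := vP j.
- rewrite exchange_big /= -w1; apply: eq_bigr => j _.
  by rewrite -mulr_sumr; have [_ -> _] := vP j; rewrite mulr1.
- under [RHS]eq_bigr do rewrite scaler_suml.
  rewrite exchange_big /=; apply: eq_bigr => j _.
  have [_ _ ->] := vP j; rewrite scaler_sumr.
  by apply: eq_bigr => k _; rewrite scalerA.
Qed.

Lemma mem_hull s x : x \in s -> hull s x.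
Proof.
move=> xs; have xi : (index x s < size s)%N by rewrite index_mem.
exists (fun j => (j == Ordinal xi)%:R); split=> [j||]; first exact: ler0n.
  by rewrite (bigD1 (Ordinal xi)) //= eqxx big1 ?addr0 // => j /negbTE ->.
rewrite (bigD1 (Ordinal xi)) //= eqxx scale1r nth_index // big1 ?addr0 //.
by move=> j /negbTE ->; rewrite scale0r.
Qed.

End Hulls.

Section RayCoordinate.
Context {R : realType}.
Variables (F : 'rV[R]_3 -> R) (a e1 e2 e3 p q r : 'rV[R]_3).
Variables (alpha : 'rV[R]_2 -> R) (b : 'rV[R]_3).
Hypothesis F_cts : continuous F.
Hypothesis Fa : F a != 0.
Hypothesis be1 : dotv b (e1 - a) = 1.
Hypothesis be2 : dotv b (e2 - a) = 1.
Hypothesis be3 : dotv b (e3 - a) = 1.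
Hypothesis hp : hull [:: a; e1] p.
Hypothesis hq : hull [:: a; e2] q.
Hypothesis hr : hull [:: a; e3] r.
Hypothesis Fp : F p = 0.
Hypothesis Fq : F q = 0.
Hypothesis Fr : F r = 0.
Hypothesis alphaP : forall l, Khat l ->
  unique (ray_hits F a e1 e2 e3 p q r l) (alpha l).

Let X l := flat_param a p q r l.
Let rho l := dotv b (X l).

Lemma edge_point e x : dotv b (e - a) = 1 -> hull [:: a; e] x -> F x = 0 ->
  0 < dotv b (x - a) <= 1 /\ x - a = dotv b (x - a) *: (e - a).
Proof.
move=> be /hull_segmentP[t /andP[t0 t1] xE] Fx.
have -> : x - a = t *: (e - a) by rewrite xE addrC addKr.
rewrite dotvZr be mulr1 t1 andbT; split=> //.
rewrite lt_neqAle t0 andbT; apply/eqP => t00; move: Fa.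
by rewrite -Fx xE -t00 scale0r addr0 eqxx.
Qed.

Let P1 := edge_point be1 hp Fp.
Let P2 := edge_point be2 hq Fq.
Let P3 := edge_point be3 hr Fr.

Lemma rhoE l : rho l = (1 - l 0 0 - l 0 1) * dotv b (p - a) +
  l 0 0 * dotv b (q - a) + l 0 1 * dotv b (r - a).
Proof. by rewrite /rho /X /flat_param (dotvDr _ (_ + _)) (dotvDr _ (_ *: _)) !dotvZr. Qed.

Lemma rho_ge (c : R) l : c <= dotv b (p - a) -> c <= dotv b (q - a) ->
  c <= dotv b (r - a) -> Khat l -> c <= rho l.
Proof. by move=> cp cq cr [l0 l1 l01]; rewrite rhoE; nra. Qed.

(** rho measures how far a point of the ray is on its way from the apex to the
    face e1 e2 e3, so the ray leaves the piece when t rho = 1.  This makes the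
    membership in the piece a closed condition on (l, t). *)
Lemma ray_hitsE l t : Khat l -> ray_hits F a e1 e2 e3 p q r l t <->
  [/\ 0 < t, t * rho l <= 1 & F (a + t *: X l) = 0].
Proof.
move=> [l0 l1 l01]; have [/andP[p0 _] pE] := P1; have [/andP[q0 _] qE] := P2.
have [/andP[r0 _] rE] := P3.
split=> [[t0 /hull_tetraP[w1 [w2 [w3 [_ _ _ w123 e]]]] Ft]|[t0 trho Ft]].
  split=> //; move/(congr1 (fun u => dotv b (u - a))): e.
  rewrite ![a + _]addrC !addrK (dotvDr _ (_ + _)) (dotvDr _ (_ *: _)) !dotvZr be1 be2 be3 !mulr1.
  by rewrite /rho /X => ->.
split=> //; apply/hull_tetraP.
exists (t * ((1 - l 0 0 - l 0 1) * dotv b (p - a))), (t * (l 0 0 * dotv b (q - a))),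
  (t * (l 0 1 * dotv b (r - a))).
have l2 : 0 <= 1 - l 0 0 - l 0 1 by lra.
split; try by apply: (mulr_ge0 (ltW t0)); apply: mulr_ge0 => //; exact: ltW.
  by move: trho; rewrite rhoE !mulrDr.
by rewrite -!scalerA -pE -qE -rE -!scalerDr.
Qed.

Lemma rho_gt0 : exists2 c : R, 0 < c & forall l, Khat l -> c <= rho l.
Proof.
have [/andP[p0 _] _] := P1; have [/andP[q0 _] _] := P2; have [/andP[r0 _] _] := P3.
exists (Num.min (dotv b (p - a)) (Num.min (dotv b (q - a)) (dotv b (r - a)))).
  by rewrite !lt_min p0 q0 r0.
by move=> l; apply: rho_ge; rewrite !ge_min lexx ?orbT.
Qed.

Lemma alpha_spec l : Khat l ->
  [/\ 0 < alpha l, alpha l * rho l <= 1 & F (a + alpha l *: X l) = 0].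
Proof. by move=> Kl; apply/(ray_hitsE _ Kl); have [] := alphaP Kl. Qed.

Lemma alpha_le_inv (c : R) l : 0 < c -> (forall x, Khat x -> c <= rho x) ->
  Khat l -> alpha l <= c^-1.
Proof.
move=> c0 cr Kl; have [a0 a1 _] := alpha_spec Kl.
rewrite -[leRHS]mul1r ler_pdivlMr // (le_trans _ a1) // ler_wpM2l ?(ltW a0) //.
exact: cr.
Qed.

Lemma alpha_unique l t : Khat l -> 0 < t -> t * rho l <= 1 ->
  F (a + t *: X l) = 0 -> alpha l = t.
Proof.
by move=> Kl t0 tr Ft; have [_ u] := alphaP Kl; apply: u; apply/(ray_hitsE _ Kl).
Qed.

Let graph (l : 'rV[R]_2) := (alpha x @[x --> within Khat (nbhs l)]).

Lemma cluster_graph_le l t (H : 'rV[R]_2 -> R -> R) :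
  H x.1 x.2 @[x --> (nbhs l, nbhs t)] --> H l t ->
  (forall x, Khat x -> H x (alpha x) <= 0) ->
  cluster (graph l) t -> H l t <= 0.
Proof.
move=> Hc Hle clt; rewrite leNgt; apply/negP => H0.
have [[U W] [/= nU nW] UW] := cvgr_gt _ Hc 0 H0.
have [|y [[x [Kx Ux <-]] Wx]] := clt [set alpha x | x in Khat `&` U] W _ nW.
  by apply: filterS nU => x Ux Kx; exists x.
have /= := UW (x, alpha x) (conj Ux Wx).
by rewrite ltNge Hle.
Qed.

(** A limit point t of alpha at l satisfies the closed conditions t >= 0,
    t rho <= 1 and F = 0, and t <> 0 because F does not vanish at the apex; by
    uniqueness t = alpha l.  As alpha is bounded, it converges. *)
Lemma alpha_cvg l : Khat l -> alpha x @[x --> within Khat (nbhs l)] --> alpha l.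
Proof.
move=> Kl; have [c c0 crho] := rho_gt0.
have PF : ProperFilter (within Khat (nbhs l)).
  by apply: Build_ProperFilter => n0; exact: (nbhs_singleton n0 Kl).
have Xc (t : R) : X x.1 @[x --> (nbhs l, nbhs t)] --> X l.
  by apply: flat_param_cvg; exact: cvg_fst.
have sc (t : R) : x.2 @[x --> (nbhs l, nbhs t)] --> t by exact: cvg_snd.
have Yc (t : R) : F (a + x.2 *: X x.1) @[x --> (nbhs l, nbhs t)] --> F (a + t *: X l).
  apply: (@cvg_comp _ _ _ (fun x => a + x.2 *: X x.1) F _ (nbhs (a + t *: X l)));
    last exact: F_cts.
  by apply: cvgD; [exact: cvg_cst|apply: cvgZ; [exact: sc|exact: Xc]].
(* A compact neighbourhood of every value of alpha. *)
apply: (@compact_cluster_set1 _ _ _ `[- 1, c^-1 + 1]%classic).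
- exact: Rhausdorff.
- exact: segment_compact.
- have := @near_in_itvoo R (- 1) (c^-1 + 1) (alpha l).
  have [a0 _ _] := alpha_spec Kl; have ac := alpha_le_inv c0 crho Kl.
  move=> /(_ _)[]; first by rewrite in_itv /=; lra.
  move=> e /= e0 eP; exists e => //= x /eP /=.
  by rewrite !in_itv /= => /andP[? ?]; rewrite !ltW.
- apply: (@filterS _ (within Khat (nbhs l)) _ Khat); last exact: withinT.
  move=> x Kx /=; have [a0 _ _] := alpha_spec Kx.
  by have ac := alpha_le_inv c0 crho Kx; rewrite in_itv /=; lra.
- apply/seteqP; split=> t /=.
    move=> clt.
    have t0 : - t <= 0.
      apply: (@cluster_graph_le l t (fun _ t => - t)) clt.
        by apply: cvgN; exact: sc.
      by move=> x /alpha_spec[a0 _ _]; rewrite oppr_le0 ltW.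
    have t1 : t * rho l - 1 <= 0.
      apply: (@cluster_graph_le l t (fun l t => t * rho l - 1)) clt.
        apply: cvgB; last exact: cvg_cst.
        apply: cvgM; first exact: sc.
        by apply: cvg_dotv; [exact: cvg_cst|exact: Xc].
      by move=> x /alpha_spec[_ a1 _]; rewrite subr_le0.
    have F1 : F (a + t *: X l) <= 0.
      apply: (@cluster_graph_le l t (fun l t => F (a + t *: X l))) clt; first exact: Yc.
      by move=> x /alpha_spec[_ _ ->].
    have F2 : - F (a + t *: X l) <= 0.
      apply: (@cluster_graph_le l t (fun l t => - F (a + t *: X l))) clt.
        by apply: cvgN; exact: Yc.
      by move=> x /alpha_spec[_ _ ->]; rewrite oppr0.
    have Ft : F (a + t *: X l) = 0 by lra.
    apply/esym/alpha_unique => //; last by lra.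
    rewrite lt_neqAle -oppr_le0 t0 andbT; apply/eqP => t00.
    by move: Fa; rewrite -Ft -t00 scale0r addr0 eqxx.
  move=> -> A W nA nW; exists (alpha l); split; last exact: nbhs_singleton.
  exact: (nbhs_singleton nA).
Qed.

End RayCoordinate.

(** * Bounds for one chart *)

Section ChartBounds.
Context {R : realType}.
Variables (F : 'rV[R]_3 -> R) (kappa G C D B : R).
Hypothesis kappa_gt0 : 0 < kappa.
Hypothesis G_gt0 : 0 < G.
Hypothesis C_ge0 : 0 <= C.
Hypothesis D_gt0 : 0 < D.
Hypothesis B_gt0 : 0 < B.
Hypothesis F_cts : continuous F.
Hypothesis grad_le : forall z, F z = 0 -> `|grad F z| <= G.
Hypothesis secant : forall z w, F z = 0 -> F w = 0 ->
  `|dotv (grad F z) (w - z)| <= C * `|w - z| ^+ 2.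
Hypothesis level_le : forall z, F z = 0 -> `|z| <= D.

Let G' := 3%:R * G.
Let D' := D + D.
Let K := 1 + 2 * G' / kappa + D' * (1 + 2 * G' / kappa) * (8 * C + 1) / kappa.

(** The sum of the constants in the bounds below, K being the ratio that
    [comparable_radii] gives. *)
Definition chart_const : R := K + K * (B * D') + K * (K * B) + K / kappa + 8 * C * K ^+ 2.

Variables (a e1 e2 e3 p q r b : 'rV[R]_3) (alpha : 'rV[R]_2 -> R) (h : R).
Hypothesis h_gt0 : 0 < h.
Hypothesis Fa : F a != 0.
Hypothesis b_le : forall u, `|dotv b u| <= B / h * `|u|.
Hypothesis be1 : dotv b (e1 - a) = 1.
Hypothesis be2 : dotv b (e2 - a) = 1.
Hypothesis be3 : dotv b (e3 - a) = 1.
Hypothesis e1_le : `|e1 - a| <= h.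
Hypothesis e2_le : `|e2 - a| <= h.
Hypothesis e3_le : `|e3 - a| <= h.
Hypothesis hp : hull [:: a; e1] p.
Hypothesis hq : hull [:: a; e2] q.
Hypothesis hr : hull [:: a; e3] r.
Hypothesis Fp : F p = 0.
Hypothesis Fq : F q = 0.
Hypothesis Fr : F r = 0.
Hypothesis alphaP : forall l, Khat l ->
  unique (ray_hits F a e1 e2 e3 p q r l) (alpha l).
Hypothesis transversal : forall y, hull [:: a; e1; e2; e3] y -> F y = 0 ->
  kappa * `|y - a| <= `|dotv (grad F y) (y - a)|.
Hypothesis separated : exists p' p'', [/\ p' \in [:: p; q; r], p'' \in [:: p; q; r] &
  `|p' - a| <= B * `|p' - p''|].

Let X l := flat_param a p q r l.
Let z l := alpha l *: X l.
Let s := `|p - a|.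

Let spec := alpha_spec Fa be1 be2 be3 hp hq hr Fp Fq Fr alphaP.

Lemma ratio_ge1 : 1 <= K.
Proof.
have G'0 : 0 <= 2 * G' / kappa.
  by apply: divr_ge0; [apply: mulr_ge0 => //; apply: mulr_ge0 => //; exact: ltW|exact: ltW].
have D'0 : 0 <= D' by rewrite addr_ge0 // ltW.
have D'1 : 0 <= D' * (1 + 2 * G' / kappa) * (8 * C + 1) / kappa.
  apply: divr_ge0; last exact: ltW.
  apply: mulr_ge0; last by rewrite addr_ge0 // mulr_ge0.
  by apply: mulr_ge0 => //; rewrite addr_ge0.
by rewrite /K -addrA lerDl addr_ge0.
Qed.

Lemma hit_zero l : Khat l -> F (a + z l) = 0.
Proof. by case/spec. Qed.

Lemma hit_cvg l : Khat l -> z x @[x --> within Khat (nbhs l)] --> z l.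
Proof.
move=> Kl; apply: cvgZ.
  exact: (alpha_cvg F_cts Fa be1 be2 be3 hp hq hr Fp Fq Fr alphaP Kl).
by apply: flat_param_cvg; apply: cvg_within_filter; exact: cvg_id.
Qed.

Lemma hit_transversal l : Khat l -> kappa * `|z l| <= `|dotv (grad F (a + z l)) (z l)|.
Proof.
move=> Kl; have [[_ ht Ft] _] := alphaP Kl.
by have := transversal ht Ft; rewrite addrC addKr.
Qed.

(** Tangency replaces grad F . z by grad F . z' in the transversality of z, up to
    a quadratic error. *)
Lemma hit_comparable l l' : Khat l -> Khat l' -> `|z l| <= K * `|z l'|.
Proof.
have D'0 : 0 < D' by rewrite addr_gt0.
have G'0 : 0 < G' by rewrite mulr_gt0.
apply: (comparable_radii hit_cvg kappa_gt0 G'0 C_ge0 D'0) => {}l {}l' Kl Kl'.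
  apply: (le_trans (hit_transversal Kl)).
  set g := grad F (a + z l).
  have -> : dotv g (z l) = dotv g (z l') - dotv g (z l' - z l).
    by rewrite -dotvNr -dotvDr opprB addrC subrK.
  apply: (le_trans (ler_normB _ _)); apply: lerD.
    apply: (le_trans (ler_dotv _ _)); rewrite ler_wpM2r //.
    by rewrite /G' ler_wpM2l // grad_le // hit_zero.
  have := secant (hit_zero Kl) (hit_zero Kl').
  rewrite opprD addrACA subrr add0r -/g => /le_trans; apply.
  by rewrite distrC.
rewrite (_ : z l - z l' = (a + z l) - (a + z l')); last first.
  by rewrite opprD addrACA subrr add0r.
by apply: (le_trans (ler_normB _ _)); rewrite lerD // level_le // hit_zero.
Qed.

(** At the three corners of the parameter triangle the ray is an edge at the
   apex and the hit is the given point of that edge. *)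
Lemma corner_hit l e x : Khat l -> X l = x - a -> dotv b (e - a) = 1 ->
  hull [:: a; e] x -> F x = 0 -> z l = x - a.
Proof.
move=> Kl Xl be hx Fx; have [/andP[x0 x1] _] := edge_point Fa be hx Fx.
rewrite /z (alpha_unique Fa be1 be2 be3 hp hq hr Fp Fq Fr alphaP Kl (t := 1)) //.
- by rewrite scale1r.
- by rewrite -/(X l) Xl mul1r.
- by rewrite -/(X l) Xl scale1r addrC subrK.
Qed.

Lemma corner_hits : exists l1 l2 l3, [/\ Khat l1 /\ z l1 = p - a,
  Khat l2 /\ z l2 = q - a & Khat l3 /\ z l3 = r - a].
Proof.
exists 0, (delta_mx 0 0), (delta_mx 0 1).
have K1 : Khat (0 : 'rV[R]_2) by split; rewrite !mxE // addr0.
have K2 : Khat (delta_mx 0 0 : 'rV[R]_2) by split; rewrite !mxE //= addr0.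
have K3 : Khat (delta_mx 0 1 : 'rV[R]_2) by split; rewrite !mxE //= add0r.
split; split => //.
- apply: (corner_hit K1 _ be1 hp Fp).
  by rewrite /X /flat_param !mxE !subr0 !scale0r !addr0 scale1r.
- apply: (corner_hit K2 _ be2 hq Fq).
  by rewrite /X /flat_param !mxE /= subr0 subrr !scale0r scale1r add0r addr0.
- apply: (corner_hit K3 _ be3 hr Fr).
  by rewrite /X /flat_param !mxE /= subr0 subrr !scale0r scale1r !add0r.
Qed.

Lemma apex_dist_gt0 : 0 < s.
Proof. by rewrite normr_gt0 subr_eq0; apply: contra_neq Fa => <-. Qed.

Lemma hit_le l : Khat l -> `|z l| <= K * s.
Proof.
by have [l1 [_ [_ [[K1 z1] _ _]]]] := corner_hits; rewrite /s -z1 => Kl; exact: hit_comparable.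
Qed.

Lemma hit_ge l : Khat l -> s <= K * `|z l|.
Proof.
by have [l1 [_ [_ [[K1 z1] _ _]]]] := corner_hits; rewrite /s -z1 => Kl; exact: hit_comparable.
Qed.

Lemma section_points x : x \in [:: p; q; r] ->
  [/\ F x = 0, `|x - a| <= K * s, s <= K * `|x - a| & s <= K * (h * dotv b (x - a))].
Proof.
have [l1 [l2 [l3 [[K1 z1] [K2 z2] [K3 z3]]]]] := corner_hits.
have edge e y : dotv b (e - a) = 1 -> hull [:: a; e] y -> F y = 0 -> `|e - a| <= h ->
    `|y - a| <= h * dotv b (y - a).
  move=> be hy Fy eh; have [/andP[y0 _] yE] := edge_point Fa be hy Fy.
  by rewrite {1}yE normrZ gtr0_norm // mulrC ler_wpM2r // ltW.
have K0 : 0 <= K := le_trans ler01 ratio_ge1.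
have main y e l : Khat l -> z l = y - a -> dotv b (e - a) = 1 -> hull [:: a; e] y ->
    F y = 0 -> `|e - a| <= h ->
    [/\ F y = 0, `|y - a| <= K * s, s <= K * `|y - a| & s <= K * (h * dotv b (y - a))].
  move=> Kl zl be hy Fy eh; split; rewrite -?zl ?hit_le ?hit_ge //.
  by rewrite (le_trans (hit_ge Kl)) // ler_wpM2l // zl (edge e).
rewrite !inE => /or3P[] /eqP ->.
- exact: (main _ _ _ K1 z1 be1).
- exact: (main _ _ _ K2 z2 be2).
- exact: (main _ _ _ K3 z3 be3).
Qed.

(** alpha = |z| / |X|, and b . X, a convex combination of the b . (x - a) for
    x = p, q, r, is at least of order s / h, while b has norm O(1/h). *)
Lemma chart_alpha_le l : Khat l -> `|alpha l| <= K * (K * B).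
Proof.
move=> Kl; have K0 : 0 < K := lt_le_trans ltr01 ratio_ge1.
have [a0 _ _] := spec Kl.
have sX : s <= K * B * `|X l|.
  have rho : s / (K * h) <= dotv b (X l).
    have le_rho x : x \in [:: p; q; r] -> s / (K * h) <= dotv b (x - a).
      move=> /section_points[_ _ _ sx].
      by rewrite ler_pdivrMr ?mulr_gt0 // mulrC -mulrA.
    by apply: (rho_ge _ _ _ Kl); apply: le_rho; rewrite !inE eqxx ?orbT.
  have := le_trans rho (le_trans (ler_norm _) (b_le (X l))).
  rewrite ler_pdivrMr ?mulr_gt0 //.
  by have -> // : B / h * `|X l| * (K * h) = K * B * `|X l|; field; rewrite gt_eqF.
have X0 : 0 < `|X l|.
  rewrite lt_neqAle eq_sym normr_ge0 andbT; apply/eqP => X0.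
  by move: sX; rewrite X0 mulr0 leNgt apex_dist_gt0.
rewrite -(ler_pM2r X0) -normrZ (le_trans (hit_le Kl)) // -!mulrA ler_pM2l //.
by rewrite !mulrA.
Qed.

(** Up to the factor B, two of the points p, q, r are as far apart as one of them
    is from the apex, and both lie on the bounded level set. *)
Lemma chart_s_le : s <= K * (B * D').
Proof.
have [p' [p'' [pp' pp'' sep]]] := separated.
have [Fp' _ sp _] := section_points pp'; have [Fp'' _ _ _] := section_points pp''.
apply: (le_trans sp); rewrite ler_wpM2l ?(le_trans ler01 ratio_ge1) //.
apply: (le_trans sep); rewrite ler_wpM2l ?(ltW B_gt0) //.
by apply: (le_trans (ler_normB _ _)); rewrite lerD // level_le.
Qed.

Lemma chart_radial l : Khat l -> s <= K / kappa * `|dotv (grad F (a + z l)) (z l)|.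
Proof.
move=> Kl; apply: (le_trans (hit_ge Kl)); rewrite -mulrA ler_wpM2l ?(le_trans ler01 ratio_ge1) //.
by rewrite ler_pdivlMl // hit_transversal.
Qed.

Lemma chart_tangential l x y : Khat l -> x \in [:: p; q; r] -> y \in [:: p; q; r] ->
  `|dotv (grad F (a + z l)) (x - y)| <= 8 * C * K ^+ 2 * s ^+ 2.
Proof.
move=> Kl xp yp; have K0 : 0 <= K := le_trans ler01 ratio_ge1.
have near x' : x' \in [:: p; q; r] ->
    `|dotv (grad F (a + z l)) (x' - (a + z l))| <= C * (2 * K * s) ^+ 2.
  move=> /section_points[Fx xs _ _].
  apply: (le_trans (secant (hit_zero Kl) Fx)); rewrite ler_wpM2l //.
  have far : `|x' - (a + z l)| <= 2 * K * s.
    rewrite opprD addrA (le_trans (ler_normB _ _)) //.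
    have -> : 2 * K * s = K * s + K * s by ring.
    by rewrite lerD // hit_le.
  by apply: lerXn2r far; rewrite ?nnegrE ?mulr_ge0 // /s.
rewrite (_ : x - y = (x - (a + z l)) - (y - (a + z l))); last first.
  by rewrite opprB addrA subrK.
rewrite dotvDr dotvNr (le_trans (ler_normB _ _)) //.
have -> : 8 * C * K ^+ 2 * s ^+ 2 = C * (2 * K * s) ^+ 2 + C * (2 * K * s) ^+ 2 by ring.
by rewrite lerD // near.
Qed.

Lemma chart_bounds : radial_bounds F chart_const s a p q r alpha.
Proof.
have K0 : 0 <= K := le_trans ler01 ratio_ge1.
have B0 := ltW B_gt0; have k0 := ltW kappa_gt0.
have t2 : 0 <= K * (B * D').
  by apply: mulr_ge0 => //; apply: mulr_ge0 => //; rewrite addr_ge0 // ltW.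
have t3 : 0 <= K * (K * B) by rewrite !mulr_ge0.
have t4 : 0 <= K / kappa by rewrite divr_ge0.
have t5 : 0 <= 8 * C * K ^+ 2 by rewrite !mulr_ge0 // sqr_ge0.
have [c1 c2 c3 c4 c5] : [/\ K <= chart_const, K * (B * D') <= chart_const,
    K * (K * B) <= chart_const, K / kappa <= chart_const &
    8 * C * K ^+ 2 <= chart_const] by rewrite /chart_const; split; lra.
have edge x : x \in [:: p; q; r] -> `|x - a| <= chart_const * s.
  by case/section_points => _ xs _ _; rewrite (le_trans xs) // ler_wpM2r // normr_ge0.
split.
- exact: apex_dist_gt0.
- exact: le_trans chart_s_le c2.
- by split; apply: edge; rewrite !inE eqxx ?orbT.
- by move=> l Kl; exact: (alpha_cvg F_cts Fa be1 be2 be3 hp hq hr Fp Fq Fr alphaP Kl).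
- by move=> l /chart_alpha_le /le_trans; apply.
- exact: hit_zero.
- by move=> l Kl; rewrite (le_trans (chart_radial Kl)) // ler_wpM2r.
- move=> l x Kl xqr; have xs : x \in [:: p; q; r] by rewrite inE xqr orbT.
  have ps : p \in [:: p; q; r] by rewrite inE eqxx.
  by rewrite (le_trans (chart_tangential Kl xs ps)) // ler_wpM2r // sqr_ge0.
Qed.

End ChartBounds.

(** * Tetrahedra containing a ball *)

Section Tetrahedron.
Context {R : realType}.
Variables (T : tetra R) (pi : {perm 'I_4}).

Let o := T \o pi.

Lemma body_vertex k : body T (o k).
Proof. by apply: mem_hull; exact: codom_f. Qed.

Lemma body_coords x : body T x -> exists v : 'I_4 -> R,
  [/\ forall k, 0 <= v k, \sum_k v k = 1 & x = \sum_k v k *: o k].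
Proof.
have hull_size n (s : seq 'rV[R]_3) : size s = n -> hull s x ->
    exists v : 'I_n -> R, [/\ forall k, 0 <= v k, \sum_k v k = 1 & x = \sum_k v k *: s`_k].
  by move=> <-.
have sz : size (codom T) = 4 by rewrite size_codom card_ord.
move=> /(hull_size _ _ sz)[v [v0 v1 ->]].
exists (v \o pi); split=> [k||] /=; first exact: v0.
  by rewrite -v1 [RHS](reindex_inj (@perm_inj _ pi)).
rewrite (reindex_inj (@perm_inj _ pi)) /=; apply: eq_bigr => k _; congr (_ *: _).
rewrite /codom /image_mem (nth_map ord0) ?size_enum_ord //.
by congr (T _); apply: val_inj; rewrite /= nth_enum_ord.
Qed.

Lemma body_diam x y : body T x -> body T y -> `|x - y| <= size_of T.
Proof.
move=> Tx Ty; apply: (le_trans (ler_enorm _)).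
have bd z : body T z -> `|z| <= \sum_k `|o k|.
  move=> /body_coords[v [v0 v1 ->]]; apply: (le_trans (ler_norm_sum _ _ _)).
  apply: ler_sum => k _; rewrite normrZ ger0_norm // ler_piMl //.
  by rewrite -v1 (bigD1 k) //= lerDl sumr_ge0.
apply: ub_le_sup; last by exists (x, y).
exists (3%:R * (\sum_k `|o k| + \sum_k `|o k|)) => _ [[u v] [Tu Tv] <-].
apply: (le_trans (enorm_le _)); rewrite ler_wpM2l //.
by apply: (le_trans (ler_normB _ _)); rewrite lerD // bd.
Qed.

Section Apex.
Variable k0 : 'I_4.

Definition edge_matrix : 'M[R]_3 := \matrix_(j < 3) (o (lift k0 j) - o k0).

Lemma edge_matrixE j : delta_mx 0 j *m edge_matrix = o (lift k0 j) - o k0.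
Proof. by rewrite -rowE rowK. Qed.

Lemma body_cone x : body T x -> exists v : 'rV[R]_3,
  [/\ forall j, 0 <= v 0 j, \sum_j v 0 j <= 1 & x - o k0 = v *m edge_matrix].
Proof.
move=> /body_coords[v [v0 v1 ->]]; exists (\row_j v (lift k0 j)).
have sv : v k0 + \sum_j v (lift k0 j) = 1 by rewrite -v1 (bigD1_ord k0).
split=> [j||]; first by rewrite mxE.
  by under eq_bigr do rewrite mxE; rewrite -sv lerDr.
rewrite mulmx_sum_row (bigD1_ord k0) //=.
under [RHS]eq_bigr do rewrite mxE rowK scalerBr.
rewrite sumrB -scaler_suml.
have -> : \sum_(j < 3) v (lift k0 j) = 1 - v k0 by rewrite -sv addrC addKr.
by rewrite scalerBl scale1r opprB addrCA addrA.
Qed.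

Variables (rho : R) (c : 'rV[R]_3).
Hypothesis rho_gt0 : 0 < rho.
Hypothesis ball_sub : forall x, enorm (x - c) <= rho -> body T x.

(** Both ends of a segment through the centre of the ball have barycentric
   coordinates in [0, 1]; their difference expresses the direction w. *)
Lemma cone_direction (w : 'rV[R]_3) : exists2 v : 'rV[R]_3,
  w = v *m edge_matrix &
  forall d : 'cV[R]_3, (forall j, 0 <= d j 0 <= 1) ->
    `|(v *m d) 0 0| <= 3%:R / (2 * rho) * `|w|.
Proof.
have [->|w0] := eqVneq w 0.
  by exists 0 => [|d _]; rewrite mul0mx // mxE !normr0 mulr0.
have w_gt0 : 0 < `|w| by rewrite normr_gt0.
(* The factor 3 bounds the Euclidean norm by the sup norm. *)
pose u := (rho / (3%:R * `|w|)) *: w.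
have u_le : enorm u <= rho.
  apply: (le_trans (enorm_le _)).
  rewrite /u normrZ gtr0_norm ?divr_gt0 ?mulr_gt0 //.
  have -> // : 3%:R * (rho / (3%:R * `|w|) * `|w|) = rho.
  by field; rewrite gt_eqF.
have [v [v0 v1 vE]] : exists v : 'rV[R]_3,
    [/\ forall j, 0 <= v 0 j, \sum_j v 0 j <= 1 & c + u - o k0 = v *m edge_matrix].
  by apply/body_cone/ball_sub; rewrite addrC addKr.
have [v' [v0' v1' vE']] : exists v : 'rV[R]_3,
    [/\ forall j, 0 <= v 0 j, \sum_j v 0 j <= 1 & c - u - o k0 = v *m edge_matrix].
  apply/body_cone/ball_sub; rewrite addrC addKr.
  by rewrite /enorm dotvNl dotvNr opprK.
exists ((3%:R * `|w| / (2 * rho)) *: (v - v')).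
  rewrite -scalemxAl mulmxBl -vE -vE'.
  have -> : c + u - o k0 - (c - u - o k0) = 2 *: u.
    by apply/rowP => j; rewrite !mxE; ring.
  rewrite /u !scalerA -[LHS]scale1r; congr (_ *: _).
  by field; rewrite !gt_eqF.
move=> d d01; rewrite -scalemxAl mxE normrM ger0_norm; last first.
  by rewrite divr_ge0 ?mulr_ge0 // ltW.
rewrite mulmxBl; set X := _ - _.
have dot01 (x : 'rV[R]_3) : (forall j, 0 <= x 0 j) -> \sum_j x 0 j <= 1 ->
    0 <= (x *m d) 0 0 <= 1.
  move=> x0 x1; rewrite mxE; apply/andP; split.
    by apply: sumr_ge0 => j _; rewrite mulr_ge0 //; have /andP[] := d01 j.
  apply: (le_trans _ x1); apply: ler_sum => j _.
  by rewrite ler_piMr //; have /andP[] := d01 j.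
have X1 : `|X 0 0| <= 1.
  rewrite !mxE ler_norml.
  have := dot01 v v0 v1; have := dot01 v' v0' v1'; rewrite !mxE.
  by move=> /andP[? ?] /andP[? ?]; lra.
rewrite (_ : 3%:R * `|w| / (2 * rho) = 3%:R / (2 * rho) * `|w|); last by rewrite mulrAC.
by rewrite ler_piMr // mulr_ge0 // divr_ge0 // mulr_ge0 // ltW.
Qed.

(** The functional with values d on the edges at the apex: d = 1 gives the
    functional that is 1 on the opposite face, and a unit vector d gives a single
    barycentric coordinate. *)
Lemma cone_functional (d : 'cV[R]_3) : (forall j, 0 <= d j 0 <= 1) ->
  exists2 b : 'rV[R]_3, forall v, dotv b (v *m edge_matrix) = (v *m d) 0 0 &
    forall u, `|dotv b u| <= 3%:R / (2 * rho) * `|u|.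
Proof.
move=> d01; have Eu : edge_matrix \in unitmx.
  rewrite -row_full_unit -sub1mx; apply/row_subP => i.
  have [v -> _] := cone_direction (row i 1%:M); exact: submxMl.
have bE u : dotv (invmx edge_matrix *m d)^T u = (u *m invmx edge_matrix *m d) 0 0.
  by rewrite -mulmxA [RHS]mxE; apply: eq_bigr => i _; rewrite mxE mulrC.
exists (invmx edge_matrix *m d)^T => [v|u]; first by rewrite bE mulmxK.
have [v uE vd] := cone_direction u.
by rewrite bE {1}uE mulmxK // vd.
Qed.

End Apex.

Lemma inscribed_ball sigma : size_of T <= sigma * inradius (body T) ->
  0 < size_of T -> exists rho c, [/\ 0 < rho, size_of T <= 2 * sigma * rho &
    forall x, enorm (x - c) <= rho -> body T x].
Proof.
rewrite /inradius; set S := (X in sup X) => hs h0.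
have [hS|nS] := pselect (has_sup S); last first.
  by move: hs; rewrite sup_out // mulr0 leNgt h0.
have S0 : 0 <= sup S.
  have [x Sx] := hS.1; apply: (le_trans (proj1 Sx)); by apply: ub_le_sup; [exact: hS.2|exact: Sx].
have [sg0 S1] : 0 < sigma /\ 0 < sup S.
  have := lt_le_trans h0 hs.
  move: S0; rewrite le_eqVlt => /orP[/eqP <-|S0]; first by rewrite mulr0 ltxx.
  by rewrite pmulr_lgt0.
have [|rho [rho0 [c cT]] rhoS] := sup_adherent (eps := sup S / 2) _ hS.
  by rewrite divr_gt0.
exists rho, c; split; [lra| |exact: cT].
apply: (le_trans hs); have -> : 2 * sigma * rho = sigma * (2 * rho) by ring.
by rewrite ler_pM2l //; lra.
Qed.

End Tetrahedron.

(** * The charts of a cut tetrahedron *)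

Section ChartGeometry.
Context {R : realType}.
Variables (F : 'rV[R]_3 -> R) (T : tetra R) (pi : {perm 'I_4}).
Variables (a e1 e2 e3 : 'rV[R]_3).

Let o := T \o pi.

Hypothesis hchart : chart F o a e1 e2 e3.

Let on_opposite_face k0 e := body T e /\
  exists2 v : 'rV[R]_3, e - o k0 = v *m edge_matrix T pi k0 & \sum_j v 0 j = 1.

Lemma vertex_opposite k0 j : on_opposite_face k0 (o (lift k0 j)).
Proof.
split; first exact: body_vertex.
exists (delta_mx 0 j); first by rewrite edge_matrixE.
rewrite (bigD1 j) //= mxE !eqxx big1 ?addr0 // => i /negbTE ij.
by rewrite mxE ij andbF.
Qed.

Lemma segment_opposite k0 e e' x : on_opposite_face k0 e -> on_opposite_face k0 e' ->
  hull [:: e; e'] x -> on_opposite_face k0 x.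
Proof.
move=> [be [v vE v1]] [be' [v' vE' v1']] hx; split.
  by apply: (hull_sub _ hx) => y; rewrite !inE => /orP[] /eqP ->.
have [t _ ->] := (hull_segmentP _ _ _).1 hx.
exists (v + t *: (v' - v)).
  rewrite mulmxDl -scalemxAl mulmxBl -vE -vE'.
  by apply/rowP => k; rewrite !mxE; ring.
under eq_bigr do rewrite !mxE.
by rewrite big_split /= -mulr_sumr sumrB v1 v1' subrr mulr0 addr0.
Qed.

(** The splitting point m of a two-two tetrahedron lies on an edge of the face
    opposite to the apex, so all three charts look alike: the e's lie in that
    face, and at least two of them are vertices. *)
Lemma chart_vertices : exists k0 j1 j2, [/\ a = o k0 /\ F a != 0, j1 != j2,
  o (lift k0 j1) \in [:: e1; e2; e3], o (lift k0 j2) \in [:: e1; e2; e3] &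
  forall e, e \in [:: e1; e2; e3] -> on_opposite_face k0 e].
Proof.
have F0l x y : F x * F y < 0 -> F x != 0.
  by apply: contraTneq => ->; rewrite mul0r ltxx.
have F0r x y : 0 < F x * F y -> F y != 0.
  by apply: contraTneq => ->; rewrite mulr0 ltxx.
case: hchart => [[F01 _ _] aE pe|m [F01 F23 F02] mE aE pe|m [F01 F23 F02] mE aE pe].
- have E1 : (1 : 'I_4) = lift 0 0 by exact: val_inj.
  have E2 : (2%:R : 'I_4) = lift 0 1 by exact: val_inj.
  have E3 : (3%:R : 'I_4) = lift 0 2%:R by exact: val_inj.
  exists 0, 0, 1; split => //.
  + by split=> //; rewrite aE (F0l _ _ F01).
  + by rewrite (perm_mem pe) !inE -E1 eqxx.
  + by rewrite (perm_mem pe) !inE -E2 eqxx orbT.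
  + move=> e; rewrite (perm_mem pe) !inE => /or3P[] /eqP ->.
    * by rewrite E1; exact: vertex_opposite.
    * by rewrite E2; exact: vertex_opposite.
    * by rewrite E3; exact: vertex_opposite.
- have E0 : (0 : 'I_4) = lift 3%:R 0 by exact: val_inj.
  have E1 : (1 : 'I_4) = lift 3%:R 1 by exact: val_inj.
  have E2 : (2%:R : 'I_4) = lift 3%:R 2%:R by exact: val_inj.
  have [hm _] : (hull [:: o 1; o 2%:R] `&` zero_set F) m by rewrite mE.
  exists 3%:R, 0, 1; split => //.
  + by split=> //; rewrite aE (F0r _ _ F23).
  + by rewrite (perm_mem pe) !inE -E0 eqxx.
  + by rewrite (perm_mem pe) !inE -E1 eqxx orbT.
  + move=> e; rewrite (perm_mem pe) !inE => /or3P[] /eqP ->.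
    * by rewrite E0; exact: vertex_opposite.
    * by rewrite E1; exact: vertex_opposite.
    * apply: segment_opposite hm; first by rewrite E1; exact: vertex_opposite.
      by rewrite E2; exact: vertex_opposite.
- have E1 : (1 : 'I_4) = lift 0 0 by exact: val_inj.
  have E2 : (2%:R : 'I_4) = lift 0 1 by exact: val_inj.
  have E3 : (3%:R : 'I_4) = lift 0 2%:R by exact: val_inj.
  have [hm _] : (hull [:: o 1; o 2%:R] `&` zero_set F) m by rewrite mE.
  exists 0, 1, 2%:R; split => //.
  + by split=> //; rewrite aE (F0l _ _ F02).
  + by rewrite (perm_mem pe) !inE -E2 eqxx.
  + by rewrite (perm_mem pe) !inE -E3 eqxx orbT.
  + move=> e; rewrite (perm_mem pe) !inE => /or3P[] /eqP ->.
    * by rewrite E2; exact: vertex_opposite.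
    * by rewrite E3; exact: vertex_opposite.
    * apply: segment_opposite hm; first by rewrite E1; exact: vertex_opposite.
      by rewrite E2; exact: vertex_opposite.
Qed.

Lemma chart_body : hull [:: a; e1; e2; e3] `<=` body T.
Proof.
have [k0 [_ [_ [[aE _] _ _ _ opp]]]] := chart_vertices.
apply: hull_sub => x; rewrite inE => /orP[/eqP ->|xe].
  by rewrite aE; exact: body_vertex.
by have [] := opp x xe.
Qed.

Lemma apex_nonzero : F a != 0.
Proof. by have [k0 [j1 [j2 [[_ Fa] _ _ _ _]]]] := chart_vertices. Qed.

Variables (p q r : 'rV[R]_3) (sigma : R).
Hypothesis hsigma : size_of T <= sigma * inradius (body T).
Hypothesis hp : hull [:: a; e1] p.
Hypothesis hq : hull [:: a; e2] q.
Hypothesis hr : hull [:: a; e3] r.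
Hypothesis Fp : F p = 0.

Let B := 3%:R * `|sigma| + 1.
Let h := size_of T.

Lemma chart_size_gt0 : 0 < h.
Proof.
have pa : p - a != 0.
  by rewrite subr_eq0; apply: contra_neq apex_nonzero => <-.
have [ab pb] : body T a /\ body T p.
  split; apply: chart_body; first by apply: mem_hull; rewrite inE eqxx.
  by apply: (hull_sub _ hp) => x xs; apply: mem_hull; move: xs; rewrite !inE => /orP[] ->; rewrite ?orbT.
by rewrite (lt_le_trans _ (body_diam pi pb ab)) // normr_gt0.
Qed.

Lemma chart_edge_le e : e \in [:: e1; e2; e3] -> `|e - a| <= h.
Proof.
move=> ee; apply: (body_diam pi); apply: chart_body; apply: mem_hull.
  by rewrite inE ee orbT.
by rewrite inE eqxx.
Qed.

Lemma chart_ball : exists rho c, [/\ 0 < rho, 3%:R / (2 * rho) <= B / h &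
  forall x, enorm (x - c) <= rho -> body T x].
Proof.
have h0 := chart_size_gt0; have [rho [c [rho0 hrho ball]]] := inscribed_ball hsigma h0.
exists rho, c; split=> //; rewrite ler_pdivrMr ?mulr_gt0 // mulrAC ler_pdivlMr //.
have : sigma * rho <= `|sigma| * rho by rewrite ler_wpM2r ?ler_norm // ltW.
by rewrite -/h /B in hrho *; nra.
Qed.

Lemma chart_cone : exists2 b : 'rV[R]_3,
  forall e, e \in [:: e1; e2; e3] -> dotv b (e - a) = 1 &
  forall u, `|dotv b u| <= B / h * `|u|.
Proof.
have [rho [c [rho0 rhoB ball]]] := chart_ball.
have [k0 [j1 [j2 [[aE _] _ _ _ opp]]]] := chart_vertices.
have [|b bE b_le] := @cone_functional _ T pi k0 rho c rho0 ball (const_mx 1).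
  by move=> j; rewrite mxE ler01 lexx.
exists b => [e ee|u]; last by rewrite (le_trans (b_le u)) // ler_wpM2r.
have [_ [v vE v1]] := opp e ee.
rewrite aE vE bE -[RHS]v1 mxE; apply: eq_bigr => j _.
by rewrite [const_mx _ _ _]mxE mulr1.
Qed.

(** Two of the three edges at the apex are edges of T, and they diverge at an
   angle that the inscribed ball bounds below. *)
Lemma chart_separated : exists p' p'', [/\ p' \in [:: p; q; r],
  p'' \in [:: p; q; r] & `|p' - a| <= B * `|p' - p''|].
Proof.
have [rho [c [rho0 rhoB ball]]] := chart_ball.
have [k0 [j1 [j2 [[aE _] j12 e1' e2' _]]]] := chart_vertices.
have [|b bE b_le] := @cone_functional _ T pi k0 rho c rho0 ball (delta_mx j1 0).
  by move=> j; rewrite mxE eqxx andbT; case: eqP; rewrite ?ler01 ?lexx.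
have on_edge e : e \in [:: e1; e2; e3] -> exists2 x, x \in [:: p; q; r] & hull [:: a; e] x.
  by rewrite !inE => /or3P[] /eqP ->; [exists p|exists q|exists r]; rewrite ?inE ?eqxx ?orbT.
have b1 : dotv b (o (lift k0 j1) - a) = 1.
  by rewrite aE -edge_matrixE bE mul_delta_mx mxE !eqxx.
have b2 : dotv b (o (lift k0 j2) - a) = 0.
  by rewrite aE -edge_matrixE bE mul_delta_mx_0 ?mxE // eq_sym.
have [p' pp' /hull_segmentP[t /andP[t0 _] p'E]] := on_edge _ e1'.
have [p'' pp'' /hull_segmentP[t' _ p''E]] := on_edge _ e2'.
exists p', p''; split=> //.
have p'a : p' - a = t *: (o (lift k0 j1) - a) by rewrite p'E addrC addKr.
have p''a : p'' - a = t' *: (o (lift k0 j2) - a) by rewrite p''E addrC addKr.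
have bt : dotv b (p' - p'') = t.
  rewrite (_ : p' - p'' = (p' - a) - (p'' - a)); last by rewrite opprB addrA subrK.
  by rewrite dotvDr dotvNr p'a p''a !dotvZr b1 b2 mulr1 mulr0 subr0.
have h0 := chart_size_gt0.
have tB : t <= B / h * `|p' - p''|.
  rewrite -[leLHS]bt (le_trans (ler_norm _)) // (le_trans (b_le _)) //.
  by rewrite ler_wpM2r.
rewrite p'a normrZ ger0_norm // (le_trans (ler_wpM2l t0 (chart_edge_le e1'))) //.
by rewrite (le_trans (ler_wpM2r (ltW h0) tB)) // mulrAC divfK // gt_eqF.
Qed.

End ChartGeometry.

(** * Uniform bounds over all charts *)

Section Assembly.
Context {R : realType}.
Variable F : 'rV[R]_3 -> R.
Hypothesis hF : regular_level_set F.

Lemma transverse_grad c2 (gamma : R) (T : tetra R) a y :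
  0 < c2 -> 0 < gamma -> (forall z, F z = 0 -> gamma <= `|grad F z|) ->
  transverse F c2 T a -> body T y -> F y = 0 ->
  c2 * gamma * `|y - a| <= `|dotv (grad F y) (y - a)|.
Proof.
move=> c20 g0 gF tr Ty Fy; have [->|ya] := eqVneq y a.
  by rewrite subrr normr0 mulr0.
have n0 : 0 < enorm (a - y).
  by rewrite (lt_le_trans _ (ler_enorm _)) // normr_gt0 subr_eq0 eq_sym.
have gy0 : 0 < enorm (grad F y).
  by rewrite (lt_le_trans g0) // (le_trans (gF _ Fy)) // ler_enorm.
have := tr y Ty Fy; rewrite /unit_normal dotvZl dotvZr !normrM !normfV.
rewrite (gtr0_norm n0) (gtr0_norm gy0) ler_pdivlMl // ler_pdivlMl // => h.
have -> : `|dotv (grad F y) (y - a)| = `|dotv (grad F y) (a - y)|.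
  by rewrite -opprB dotvNr normrN.
apply: le_trans h; have hA : `|y - a| <= enorm (a - y) by rewrite distrC ler_enorm.
have hB : gamma <= enorm (grad F y) by rewrite (le_trans (gF _ Fy)) // ler_enorm.
have hAB : c2 * (gamma * `|y - a|) <= c2 * (enorm (grad F y) * enorm (a - y)).
  by rewrite ler_wpM2l ?(ltW c20) // ler_pM // ltW.
lra.
Qed.

Variables (sigma c2 : R).

(** The data of one chart and the properties from which its bounds follow.  As
    the index type of the graded families it makes every constant depend on F,
    sigma and c2 only. *)
Record cut_chart := CutChart {
  cc_tetra : tetra R;
  cc_label : {perm 'I_4};
  cc_a : 'rV[R]_3;
  cc_e1 : 'rV[R]_3; cc_e2 : 'rV[R]_3; cc_e3 : 'rV[R]_3;
  cc_p : 'rV[R]_3; cc_q : 'rV[R]_3; cc_r : 'rV[R]_3;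
  cc_alpha : 'rV[R]_2 -> R;
  cc_regular : size_of cc_tetra <= sigma * inradius (body cc_tetra);
  cc_transverse : transverse F c2 cc_tetra cc_a;
  cc_chart : chart F (cc_tetra \o cc_label) cc_a cc_e1 cc_e2 cc_e3;
  cc_hp : hull [:: cc_a; cc_e1] cc_p /\ F cc_p = 0;
  cc_hq : hull [:: cc_a; cc_e2] cc_q /\ F cc_q = 0;
  cc_hr : hull [:: cc_a; cc_e3] cc_r /\ F cc_r = 0;
  cc_alphaP : forall l, Khat l ->
    unique (ray_hits F cc_a cc_e1 cc_e2 cc_e3 cc_p cc_q cc_r l) (cc_alpha l)
}.

Lemma cut_chart_bounds : 0 < c2 -> exists M : R, forall w : cut_chart,
  radial_bounds F M `|cc_p w - cc_a w| (cc_a w) (cc_p w) (cc_q w) (cc_r w) (cc_alpha w).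
Proof.
move=> c20.
have [gamma g0 gF] := grad_lower hF; have [G G0 GF] := grad_bounded hF.
have [C C0 CF] := grad_secant hF; have [D D0 DF] := level_set_bounded hF.
have Fc : continuous F by have [_] := level_smooth hF [::].
set B := 3%:R * `|sigma| + 1.
have B0 : 0 < B by rewrite ltr_pwDr // mulr_ge0.
have k0 : 0 < c2 * gamma by exact: mulr_gt0.
exists (chart_const (c2 * gamma) G C D B).
case=> T pi a e1 e2 e3 p q r alpha hs tr ch [hp Fp] [hq Fq] [hr Fr] alphaP /=.
have h0 := chart_size_gt0 ch hp Fp.
have [b b1 b_le] := chart_cone ch hs hp Fp.
have edge_le := chart_edge_le ch.
have m1 : e1 \in [:: e1; e2; e3] by rewrite !inE eqxx.
have m2 : e2 \in [:: e1; e2; e3] by rewrite !inE eqxx orbT.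
have m3 : e3 \in [:: e1; e2; e3] by rewrite !inE eqxx !orbT.
apply: (chart_bounds k0 G0 C0 D0 B0 Fc GF CF DF h0 (apex_nonzero ch) b_le
  (b1 _ m1) (b1 _ m2) (b1 _ m3) (edge_le _ m1) (edge_le _ m2) (edge_le _ m3)
  hp hq hr Fp Fq Fr alphaP).
  move=> y hy Fy; exact: (transverse_grad c20 g0 gF tr (chart_body ch hy) Fy).
exact: (chart_separated ch hs hp hq hr Fp).
Qed.

End Assembly.

Unset Implicit Arguments.
Set Strict Implicit.
Set Printing Implicit Defensive.

(* C depends only on the surface (F), the shape-regularity constant sigma, the
   transversality constant c2 and the order n. *)
Theorem theorem5p2 (R : realType) (F : 'rV[R]_3 -> R)
    (hF : regular_level_set F) (sigma c2 : R) (hc2 : 0 < c2)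
    (n : nat) (hn : (1 <= n)%N) :
  exists C : R,
  forall (c0 tau : R) (I : Type) (mesh : I -> seq (tetra R))
    (lab : I -> tetra R -> {perm 'I_4}),
  0 < c0 ->
  (forall i, conforming_mesh (mesh i)) ->
  (forall i, shape_regular sigma (mesh i)) ->
  (forall i, quasi_uniform tau (mesh i)) ->
  (forall i (T : tetra R), T \in mesh i -> is_cut F T -> consistent F c0 T) ->
  (forall i (T : tetra R), T \in mesh i -> is_cut F T -> forall a e1 e2 e3,
     chart F (T \o lab i T) a e1 e2 e3 -> transverse F c2 T a) ->
  forall i (T : tetra R), T \in mesh i -> is_cut F T ->
  forall a e1 e2 e3, chart F (T \o lab i T) a e1 e2 e3 ->
  forall p q r : 'rV[R]_3,
  hull [:: a; e1] `&` zero_set F = [set p] ->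
  hull [:: a; e2] `&` zero_set F = [set q] ->
  hull [:: a; e3] `&` zero_set F = [set r] ->
  forall alpha : 'rV[R]_2 -> R,
  (forall l, Khat l ->
     unique (ray_hits F a e1 e2 e3 p q r l) (alpha l)) ->
  forall nu1 nu2 : nat, (nu1 + nu2)%N = n ->
  exists2 dz : 'rV[R]_2 -> 'rV[R]_3,
    is_partials_upto Khat (multi_index nu1 nu2)
      (surface_param a p q r alpha) dz &
    forall l, Khat l -> enorm (dz l) <= C * size_of T ^+ (n./2 + 1).
Proof.
have [M bounds] := cut_chart_bounds hF sigma hc2.
have s0 (w : cut_chart F sigma c2) : 0 <= `|cc_p w - cc_a w| by exact: normr_ge0.
have gr := graded_surface_param (level_smooth hF)
  (partials_bounded_level hF) bounds n.
have [C CP] := graded_partials_upto s0 gr.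
(* Weight 2 and n derivatives give the exponent (2 + n)./2; the factor 3 turns
   the sup norm into the Euclidean one. *)
exists (3%:R * `|C|) => c0 tau I mesh lab _ _ hshape _ _ htrans i T Tm Tcut a e1 e2 e3 ch
  p q r hp hq hr alpha alphaP nu1 nu2 nun.
have [hp' Fp] : (hull [:: a; e1] `&` zero_set F) p by rewrite hp.
have [hq' Fq] : (hull [:: a; e2] `&` zero_set F) q by rewrite hq.
have [hr' Fr] : (hull [:: a; e3] `&` zero_set F) r by rewrite hr.
pose w := CutChart (hshape i T Tm) (htrans i T Tm Tcut a e1 e2 e3 ch) ch
  (conj hp' Fp) (conj hq' Fq) (conj hr' Fr) alphaP.
have [|dz dzP dz_le] := CP (multi_index nu1 nu2) _ w.
  by rewrite size_cat !size_nseq.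
exists dz => // l Kl.
apply: (le_trans (enorm_le _)); rewrite -mulrA ler_wpM2l //.
apply: (le_trans (dz_le l Kl)).
have sh : `|cc_p w - cc_a w| <= size_of T.
  apply: (body_diam (lab i T)); apply: (chart_body ch); last by apply: mem_hull; rewrite inE eqxx.
  apply: (hull_sub _ hp') => x; rewrite !inE => xs; apply: mem_hull.
  by rewrite !inE; case/orP: xs => ->; rewrite ?orbT.
apply: (@le_trans _ _ (`|C| * `|cc_p w - cc_a w| ^+ (2 + n)./2)).
  by rewrite ler_wpM2r ?exprn_ge0 // ler_norm.
have size_ge0 : 0 <= size_of T := le_trans (normr_ge0 _) sh.
by rewrite ler_wpM2l // addn1; apply: lerXn2r sh; rewrite nnegrE.
Qed.
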